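(* Let $t\ge 1$ and let $F=\bigcup_{i=1}^{t}K_{1,p_i}$ be the vertex-disjoint union of the stars $K_{1,p_1},\dots,K_{1,p_t}$, where $p_1\ge 3$ and $p_1\ge p_2\ge\cdots\ge p_t\ge 1$. Let $s=\max\{i: p_i\ge 2,\ 1\le i\le t\}$. Then for every integer $n\ge 3t^2(p_1+1)^2$, $$ar(K_n,F)=\max\left\{\max_{1\le i\le s}\left\{(i-1)n-\binom{i}{2}+\left\lfloor\frac{p_i-2}{2}(n-i+1)\right\rfloor+1\right\},\ (t-2)n-\binom{t-1}{2}+r\right\},$$ where $r=1$ if $p_{t-1}=1$ and $r=2$ otherwise (for $t=1$, take $r=2$).
   Context: All graphs are finite and simple. A subgraph of an edge-colored graph is rainbow if all its edges receive distinct colors. For a graph $G$, the anti-Ramsey number $ar(K_n,G)$ is the maximum number of colors in an edge-coloring of the complete graph $K_n$ that contains no rainbow subgraph isomorphic to $G$. $K_{1,p}$ denotes the star with $p$ edges. *)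

(* Defs.v *)
From mathcomp Require Import all_boot all_order all_algebra.

Set Implicit Arguments.
Unset Strict Implicit.
Unset Printing Implicit Defensive.

Import Order.TTheory GRing.Theory Num.Theory.

Record sgraph := SGraph {
  vertex :> finType;
  edges : {set {set vertex}};
  edges_card2 : forall e, e \in edges -> #|e| = 2
}.

Arguments edges G : rename.

Section BasicGraphs.

Definition complete_edges (n : nat) : {set {set 'I_n}} :=
  [set e : {set 'I_n} | #|e| == 2].

Lemma complete_card2 n e : e \in complete_edges n -> #|e| = 2.
Proof. by rewrite inE => /eqP. Qed.

Definition complete (n : nat) : sgraph := SGraph (@complete_card2 n).

(* The centre of the star K_{1,p} is None and its leaves are the Some j. *)
Definition star_edges (p : nat) : {set {set option 'I_p}} :=
  [set [set None; Some j] | j : 'I_p].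

Lemma star_card2 p e : e \in star_edges p -> #|e| = 2.
Proof. by case/imsetP => j _ ->; rewrite cards2. Qed.

Definition star (p : nat) : sgraph := SGraph (@star_card2 p).

Variables (I : finType) (G : I -> sgraph).

Definition dunion_edges : {set {set {i : I & G i}}} :=
  \bigcup_(i : I)
     [set Tagged (fun j => G j : Type) @: e | e : {set G i} in edges (G i)].

Lemma dunion_card2 e : e \in dunion_edges -> #|e| = 2.
Proof.
case/bigcupP => i _ /imsetP [f Ef ->]; rewrite card_imset ?(edges_card2 Ef) //.
exact: eq_from_Tagged.
Qed.

Definition dunion : sgraph := SGraph dunion_card2.

End BasicGraphs.

Section AntiRamsey.

Variables K G : sgraph.

(* The subgraphs of K isomorphic to G are the images of G under the injections
   of vertices that send edges of G to edges of K. *)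
Definition copy_edges (f : G -> K) : {set {set K}} :=
  [set f @: e | e : {set G} in edges G].

(* Only the values of c on the edges of K matter. *)
Definition has_rainbow (C : eqType) (c : {set K} -> C) : bool :=
  [exists f : {ffun G -> K},
    [&& injectiveb f, copy_edges f \subset edges K
      & dinjectiveb c (mem (copy_edges f))]].

(* Colors are taken in {set K}, which contains the edges of K and so has
   enough elements to realize every edge coloring of K up to renaming of the
   colors; see ar_max. *)
Definition ar : nat :=
  \max_(c : {ffun {set K} -> {set K}} | ~~ has_rainbow c) #|c @: edges K|.

Lemma ar_max (C : finType) (c : {set K} -> C) :
  ~~ has_rainbow c -> #|c @: edges K| <= ar.
Proof.
move=> rbF; pose rep x := odflt set0 [pick e in edges K | c e == x].
have repK e : e \in edges K -> c (rep (c e)) = c e.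
  move=> Ke; rewrite /rep; case: pickP => [e' /andP[_ /eqP] //|/(_ e)].
  by rewrite Ke eqxx.
pose c' : {ffun {set K} -> {set K}} := [ffun e => rep (c e)].
have <- : #|c' @: edges K| = #|c @: edges K|.
  have -> : c' @: edges K = rep @: (c @: edges K).
    by rewrite -imset_comp; apply: eq_imset => e; rewrite ffunE.
  apply: card_in_imset => _ _ /imsetP[e1 K1 ->] /imsetP[e2 K2 ->].
  by move/(congr1 c); rewrite !repK.
apply: (@leq_bigmax_cond _ _ (fun c0 : {ffun {set K} -> {set K}} => #|c0 @: edges K|)).
apply: contra rbF => /existsP[f /and3P[injf subf /dinjectiveP rbf]].
apply/existsP; exists f; apply/and3P; split=> //.
by apply/dinjectiveP => e1 e2 fe1 fe2 eqc; apply: rbf => //; rewrite !ffunE eqc.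
Qed.

End AntiRamsey.

Definition star_forest (t : nat) (p : nat -> nat) : sgraph :=
  dunion (fun i : 'I_t => star (p i.+1)).

Local Open Scope ring_scope.

(* (%/ 2)%Z is the floor of the half. *)
Definition star_bound (p : nat -> nat) (n i : nat) : int :=
  (i%:Z - 1) * n%:Z - 'C(i, 2)%:Z
    + (((p i)%:Z - 2) * (n%:Z - i%:Z + 1) %/ 2)%Z + 1.

(* Main.v *)
(* Lower bound: give pairwise distinct colors to all edges meeting a fixed set A
   of i - 1 (resp. t - 2) vertices and to the edges of an almost (p_i - 2)-regular
   graph (resp. of r - 1 edges) outside A, and one further color to all the other
   edges.  A rainbow copy of F has a star among its first i ones (resp. has two
   stars) avoiding A, which needs more colors than are available outside A.

   Upper bound: let G contain one edge of each color and let H be the set of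
   vertices of degree at least t (p_1 + 1) + p_1 in G.  Stars centred in H can
   always be added greedily at the end.  If h = |H| < t, a counting argument on
   the number of pairs (vertex, color seen) produces a rainbow star of size
   p_{h+1} outside H.  All vertices outside H have bounded degree in G, so the
   number of colors leaves enough edges of G to choose the remaining stars
   greedily, in colors different from those of the first star.  The only
   exceptions are two remaining stars of sizes (1, 1) or (2, 1), for which two,
   resp. three, colors suffice. *)

Require Import Defs.
From mathcomp Require Import all_boot all_order all_algebra.
From mathcomp Require Import zify.

Set Implicit Arguments.
Unset Strict Implicit.
Unset Printing Implicit Defensive.

Import Order.TTheory GRing.Theory Num.Theory.

(** * Star forests as lists of centres and leaves *)

Section Forest.

Variable V : finType.
Implicit Types (ss : seq (V * seq V)) (v y : V) (e : {set V}).

(** A star is a pair of a centre and its list of leaves. Disjointness of the stars is then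
    [uniq (fverts ss)], and rainbow means that the colors of [fedges ss] form a duplicate-free
    list. *)
Definition fverts ss : seq V := flatten [seq x.1 :: x.2 | x <- ss].
Definition fedges ss : seq {set V} :=
  flatten [seq [seq [set x.1; y] | y <- x.2] | x <- ss].
Definition fsizes ss : seq nat := [seq size x.2 | x <- ss].

Lemma fverts_cat ss1 ss2 : fverts (ss1 ++ ss2) = fverts ss1 ++ fverts ss2.
Proof. by rewrite /fverts map_cat flatten_cat. Qed.

Lemma fedges_cat ss1 ss2 : fedges (ss1 ++ ss2) = fedges ss1 ++ fedges ss2.
Proof. by rewrite /fedges map_cat flatten_cat. Qed.

Lemma size_fverts ss : size (fverts ss) = sumn [seq k.+1 | k <- fsizes ss].
Proof. by elim: ss => //= x ss <-; rewrite /fverts /= size_cat. Qed.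

Lemma size_fedges ss : size (fedges ss) = sumn (fsizes ss).
Proof. by elim: ss => //= x ss <-; rewrite /fedges /= size_cat size_map. Qed.

Lemma set2_inj (x : V) y y' : y != x -> [set x; y] = [set x; y'] -> y = y'.
Proof.
move=> yx /setP/(_ y); rewrite !inE (negPf yx) eqxx /=.
by move/esym/eqP.
Qed.

Lemma mem_fedges ss e v : e \in fedges ss -> v \in e -> v \in fverts ss.
Proof.
case/flattenP => _ /mapP[x xs ->] /mapP[y yx ->]; rewrite !inE => vxy.
apply/flattenP; exists (x.1 :: x.2); first exact: map_f.
by rewrite inE; case/orP: vxy => /eqP->; rewrite ?eqxx ?yx ?orbT.
Qed.

Lemma uniq_fedges ss : uniq (fverts ss) -> uniq (fedges ss).
Proof.
elim: ss => //= -[x l] ss IH; rewrite /fverts /fedges /= cat_uniq.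
case/and4P=> xl ul dis /IH ue; rewrite cat_uniq ue andbT.
rewrite map_inj_in_uniq ?ul /=; last first.
  move=> y y' yl _; apply: set2_inj; apply: contraNneq xl => <-.
  by rewrite mem_cat yl.
apply/hasPn => e /mem_fedges/(_ _) ev; apply/mapP => -[y _ ee].
move: xl; rewrite mem_cat negb_or => /andP[_ /negP]; apply; apply: ev.
by rewrite ee !inE eqxx.
Qed.

(** Used for vertices, where it makes the embedding injective, and for colors, where it makes the
    copy rainbow. *)
Lemma uniq_flatten_nth (T : eqType) (z : T) (s : seq (seq T)) i j a b :
  uniq (flatten s) -> i < size s -> j < size s ->
  a < size (nth [::] s i) -> b < size (nth [::] s j) ->
  nth z (nth [::] s i) a = nth z (nth [::] s j) b -> i = j /\ a = b.
Proof.
elim: s i j => [|l s IH] [|i] [|j] //=; rewrite cat_uniq => /and3P[ul /hasPn dis us].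
- by move=> _ _ al bl /eqP; rewrite nth_uniq // => /eqP.
- move=> _ js al bl E; have /dis/negP[] : nth z l a \in flatten s.
    by apply/flattenP; exists (nth [::] s j); rewrite ?E mem_nth.
  exact: mem_nth.
- move=> js _ al bl E; have /dis/negP[] : nth z l b \in flatten s.
    by apply/flattenP; exists (nth [::] s i); rewrite -?E mem_nth.
  exact: mem_nth.
by move=> ? ? ? ? /IH[] // -> ->.
Qed.

End Forest.

Lemma rainbow_of_forest n t p (C : eqType) (c : {set 'I_n} -> C)
    (ss : seq ('I_n * seq 'I_n)) :
  uniq (fverts ss) -> uniq [seq c e | e <- fedges ss] ->
  fsizes ss = [seq p i.+1 | i <- iota 0 t] ->
  @has_rainbow (complete n) (star_forest t p) C c.
Proof.
(* The empty forest is treated apart: for positive [t] the first centre serves as the default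
   element of [nth]. *)
move=> uv ue sz; case: t sz => [|t] sz.
  have noV (i : star_forest 0 p) : False by case: i => -[].
  apply/existsP; exists [ffun i => match noV i with end].
  have E0 : edges (star_forest 0 p) = set0.
    by apply/setP=> e; rewrite inE; apply/bigcupP => -[[]].
  apply/and3P; split; first by apply/injectiveP => i; case: (noV i).
    by rewrite /copy_edges E0 imset0 sub0set.
  by apply/dinjectiveP => e; rewrite /copy_edges E0 imset0 inE.
have szs : size ss = t.+1 by rewrite -(size_map (fun x => size x.2)) -/(fsizes ss) sz size_map size_iota.
have x0 : 'I_n by case: (ss) szs => // -[].
pose st i := nth (x0, [::]) ss i.
have szi (i : 'I_t.+1) : size (st i).2 = p i.+1.
  have: nth 0 (fsizes ss) i = p i.+1 by rewrite sz (nth_map 0) ?size_iota // nth_iota.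
  by rewrite (nth_map (x0, [::])) // szs.
(* The centre takes position 0 and leaf [a] position [a.+1] in the list of a centre followed by its
   leaves. *)
pose pos (q : nat) (o : option 'I_q) := if o is Some a then a.+1 else 0.
have posK q : injective (@pos q) by move=> [a|] [b|] //= [] /val_inj->.
pose f := [ffun u : star_forest t.+1 p =>
   nth x0 ((st (tag u)).1 :: (st (tag u)).2) (pos _ (tagged u))].
have injf : injective f.
  move=> [i a] [j b]; rewrite !ffunE /= => E.
  have posb (k : 'I_t.+1) (o : option 'I_(p k.+1)) :
      pos _ o < size (nth [::] [seq x.1 :: x.2 | x <- ss] k).
    by rewrite (nth_map (x0, [::])) ?szs //= szi; case: o => //= o; rewrite ltnS.
  have [] := @uniq_flatten_nth _ x0 [seq x.1 :: x.2 | x <- ss] i j (pos _ a) (pos _ b).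
  - exact: uv.
  - by rewrite size_map szs.
  - by rewrite size_map szs.
  - exact: posb.
  - exact: posb.
  - by rewrite !(nth_map (x0, [::])) ?szs.
  by move/val_inj => ij; move: b E; rewrite -ij => b _ /posK->.
have edge e : e \in @copy_edges (complete n) (star_forest t.+1 p) f -> exists i : 'I_t.+1, exists2 a : nat, a < p i.+1 &
    e = [set (st i).1; nth x0 (st i).2 a].
  case/imsetP => _ /bigcupP[i _ /imsetP[_ /imsetP[a _ ->] ->]] ->.
  exists i; exists a => //; rewrite !imsetU1 !imset_set1 !ffunE //=.
apply/existsP; exists f; apply/and3P; split; first exact/injectiveP.
  apply/subsetP => e; case/imsetP => g /edges_card2 cg ->.
  by rewrite inE card_imset ?cg.
apply/dinjectiveP => e1 e2 /edge[i [a ai ->]] /edge[j [b bj ->]] E.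
pose cc := [seq [seq c [set x.1; y] | y <- x.2] | x <- ss].
have ecc : flatten cc = [seq c e | e <- fedges ss].
  rewrite map_flatten -map_comp; congr flatten; apply: eq_map => x /=.
  by rewrite -map_comp.
have ncc (k : 'I_t.+1) : nth [::] cc k = [seq c [set (st k).1; y] | y <- (st k).2].
  by rewrite (nth_map (x0, [::])) ?szs.
have [] := @uniq_flatten_nth _ (c set0) cc i j a b.
- by rewrite ecc.
- by rewrite size_map szs.
- by rewrite size_map szs.
- by rewrite ncc size_map szi.
- by rewrite ncc size_map szi.
- by rewrite !ncc !(nth_map x0) ?szi.
by move=> /val_inj-> ->.
Qed.

(** * Greedy choice of stars *)

Section Greedy.

Variable V : finType.
Implicit Types (ss : seq (V * seq V)) (E : {set {set V}}) (S W A : {set V}).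

Definition nbr E (v : V) : {set V} := [set y | (y != v) && ([set v; y] \in E)].

Lemma subset_seq A k :
  k <= #|A| -> exists l : seq V, [/\ uniq l, size l = k & {subset l <= A}].
Proof.
move=> kA; exists (take k (enum A)); split; first by rewrite take_uniq ?enum_uniq.
  by rewrite size_takel -?cardE.
by move=> x /mem_take; rewrite mem_enum.
Qed.

Lemma card_nbr E (v : V) :
  {in E, forall e : {set V}, #|e| = 2} -> #|nbr E v| = #|[set e in E | v \in e]|.
Proof.
move=> cardE2; have -> : [set e in E | v \in e] = [set [set v; y] | y in nbr E v].
  apply/setP=> e; apply/setIdP/imsetP => [[Ee ve]|[y]].
    have /eqP/cards2P[x [y [xy ee]]] := cardE2 _ Ee.
    move: ve Ee; rewrite {}ee !inE => /orP[]/eqP-> Ee.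
      by exists y => //; rewrite inE eq_sym xy.
    by exists x; rewrite 1?setUC // inE xy setUC.
  by rewrite inE => /andP[_ vy] ->; rewrite !inE eqxx.
by rewrite card_in_imset // => y y'; rewrite !inE => /andP[yv _] _; apply: set2_inj.
Qed.

Lemma handshake E : {in E, forall e : {set V}, #|e| = 2} -> \sum_v #|nbr E v| = 2 * #|E|.
Proof.
move=> cardE2; under eq_bigr do rewrite card_nbr // -sum1_card.
under eq_bigr => v _ do under eq_bigl do rewrite inE.
rewrite (exchange_big_dep (mem E)) /=; last by move=> v e _ /andP[].
rewrite mulnC -sum_nat_const; apply: eq_bigr => e Ee.
by rewrite -(cardE2 _ Ee) -sum1_card; apply: eq_bigl => v; rewrite Ee.
Qed.

Variables (E : {set {set V}}) (d : nat).
Hypothesis cardE2 : {in E, forall e : {set V}, #|e| = 2}.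
Hypothesis maxdeg : forall v, #|nbr E v| <= d.

(** An edge not avoiding [S] contains a vertex of [S], and each such vertex lies on at most [d]
    edges. *)
Lemma card_edges_avoid S : #|E| <= #|[set e in E | [disjoint e & S]]| + d * #|S|.
Proof.
have [cov ->] : #|E| <= \sum_(e in E) ([disjoint e & S] + \sum_(v in S) (v \in e)) /\
    d * #|S| = \sum_(v in S) d.
  split; last by rewrite sum_nat_const mulnC.
  rewrite -sum1_card; apply: leq_sum => e _.
  case: (boolP [disjoint e & S]) => //=; rewrite -setI_eq0 => /set0Pn[v /setIP[ve vS]].
  by rewrite (bigD1 v) //= ve.
apply: leq_trans cov _; rewrite big_split /= leq_add //.
  rewrite -sum1_card; under [X in _ <= X]eq_bigl do rewrite inE.
  by rewrite big_mkcondr; apply: leq_sum => e _; case: ifP.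
rewrite exchange_big; apply: leq_sum => v _; apply: leq_trans (maxdeg v).
rewrite card_nbr // -sum1_card; under [X in _ <= X]eq_bigl do rewrite inE.
by rewrite big_mkcondr; apply: leq_sum => e _; case: ifP.
Qed.

(** Deleting the edges that meet [S] costs at most [d * #|S|] edges; what is left has average degree
    above [q], so some vertex has at least [q.+1] neighbours. *)
Lemma exists_star q k S :
  k <= q.+1 -> q * #|V| + 2 * (d * #|S|) < 2 * #|E| ->
  exists x l, [/\ uniq (x :: l), size l = k, {in x :: l, forall y, y \notin S} &
    {in l, forall y, [set x; y] \in E}].
Proof.
move=> kq big; pose F := [set e in E | [disjoint e & S]].
have F2 : {in F, forall e : {set V}, #|e| = 2} by move=> e /setIdP[/cardE2].
have [x dx] : exists x, q < #|nbr F x|.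
  apply/existsP; apply: contraLR big; rewrite negb_exists -leqNgt => /forallP le.
  have : \sum_v #|nbr F v| <= q * #|V|.
    rewrite -(mulnC #|V|) -sum_nat_const; apply: leq_sum => v _.
    by rewrite leqNgt le.
  by have := card_edges_avoid S; rewrite -/F handshake //; lia.
have [l [ul szl lF]] := subset_seq (leq_trans kq dx).
have lx y : y \in nbr F x -> [/\ y != x, [set x; y] \in E, x \notin S & y \notin S].
  rewrite !inE => /and3P[yx xyE dis]; split=> //; apply/negP => zS;
    by have := disjointFl dis zS; rewrite !inE eqxx ?orbT.
exists x, l; split=> //.
- rewrite /= ul andbT; apply/negP => /lF/lx[].
  by rewrite eqxx.
(* As [k] may be 0, [x \notin S] is read off from an arbitrary neighbour of [x]. *)
- have [y /lx[_ _ xS _]] : exists y, y \in nbr F x.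
    by apply/set0Pn; rewrite -card_gt0; apply: leq_trans dx.
  by move=> z; rewrite inE => /orP[/eqP->//|/lF/lx[]].
by move=> y /lF/lx[].
Qed.

(** Each star placed blocks at most [q.+2] further vertices for the later ones; nothing follows the
    last star, whence the predecessor of [size ks]. *)
Lemma greedy_free q ks S :
  {in ks, forall k, k <= q.+1} ->
  q * #|V| + 2 * (d * (#|S| + (size ks).-1 * q.+2)) < 2 * #|E| ->
  exists ss, [/\ fsizes ss = ks, uniq (fverts ss),
    {in fverts ss, forall v, v \notin S} & {subset fedges ss <= E}].
Proof.
elim: ks S => [|k ks IH] S ksq big; first by exists [::].
have kq : k <= q.+1 by apply: ksq; rewrite inE eqxx.
have [|x [l [uxl szl xlS xlE]]] := @exists_star q k S kq; first by move: big => /=; nia.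
have ksq' : {in ks, forall k0, k0 <= q.+1} by move=> k0 k0s; apply: ksq; rewrite inE k0s orbT.
have [ss [sz us ssS ssE]] : exists ss, [/\ fsizes ss = ks, uniq (fverts ss),
    {in fverts ss, forall v, v \notin S :|: [set y in x :: l]} & {subset fedges ss <= E}].
  case: ks IH big ksq' {ksq} => [|k' ks] IH big ksq'; first by exists [::].
  apply: IH => //; apply: leq_ltn_trans big; rewrite leq_add2l leq_mul2l leq_mul2l.
  have : #|S :|: [set y in x :: l]| <= #|S| + k.+1.
    apply: leq_trans (leq_card_setU _ _) _; rewrite leq_add2l cardsE.
    by rewrite -szl; apply: (card_size (x :: l)).
  by rewrite /= mulSn => le; rewrite addnA leq_add2r (leq_trans le) ?orbT // leq_add2l.
exists ((x, l) :: ss); split.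
- by rewrite /fsizes /= szl -sz.
- rewrite (cat_uniq (x :: l) (fverts ss)) uxl us andbT.
  by apply/hasPn => v /ssS; apply: contra => vxl; rewrite !inE orbC -in_cons vxl.
- move=> v; rewrite (mem_cat v (x :: l) (fverts ss)) => /orP[/xlS//|/ssS].
  by rewrite inE negb_or => /andP[].
move=> e; rewrite /fedges /= mem_cat => /orP[/mapP[y yl ->]|/ssE//].
exact: xlE.
Qed.

(** [W] collects the blocked vertices, among them all centres. Placing a star moves its [k] leaves
    into [W] and takes [k] off [sumn ks], so the degree condition persists. *)
Lemma greedy_centers hs ks W :
  uniq hs -> {subset hs <= W} -> size ks = size hs ->
  {in hs, forall x, #|W| + sumn ks <= #|nbr E x|} ->
  exists ss, [/\ fsizes ss = ks, uniq (fverts ss),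
    {in fverts ss, forall v, (v \in hs) || (v \notin W)} & {subset fedges ss <= E}].
Proof.
elim: hs ks W => [|x hs IH] [|k ks] W //=; first by exists [::].
case/andP=> xhs uhs hsW [szk] big.
have [l [ul szl lN]] : exists l : seq V,
    [/\ uniq l, size l = k & {subset l <= nbr E x :\: W}].
  apply: subset_seq; have := big x (mem_head _ _).
  rewrite -(cardsID W (nbr E x)); have := subset_leq_card (subsetIr (nbr E x) W).
  by lia.
have lx y : y \in l -> [/\ y != x, [set x; y] \in E & y \notin W].
  by move/lN; rewrite !inE => /and3P[].
have xW : x \in W by apply: hsW; rewrite inE eqxx.
have hsW' y : y \in hs -> y \in W by move=> yh; apply: hsW; rewrite inE yh orbT.
have [|//|y yh|ss [sz us ssW ssE]] := IH ks (W :|: [set y in l]) uhs.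
- by move=> y /hsW'; rewrite inE => ->.
- apply: leq_trans (big y _); last by rewrite inE yh orbT.
  rewrite addnA leq_add2r (leq_trans (leq_card_setU _ _)) // leq_add2l cardsE -szl.
  exact: card_size.
have ssW' v : v \in fverts ss -> (v \in hs) || (v \notin W) && (v \notin l).
  by move/ssW; rewrite !inE negb_or.
exists ((x, l) :: ss); split.
- by rewrite /fsizes /= szl -sz.
- rewrite /fverts /= mem_cat negb_or cat_uniq ul [uniq _]us andbT /=.
  apply/andP; split; last first.
    apply/hasPn => v /ssW'/orP[/hsW' vW|/andP[]//]; apply/negP => /lx[_ _].
    by rewrite vW.
  apply/andP; split; first by apply/negP => /lx[]; rewrite eqxx.
  by apply/negP => /ssW'; rewrite (negPf xhs) xW.
- move=> v; rewrite /fverts /= inE mem_cat inE => /or3P[->//|/lx[_ _ ->]|/ssW'].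
    by rewrite orbT.
  by case/orP=> [->|/andP[->]]; rewrite ?orbT.
move=> e; rewrite /fedges /= mem_cat => /orP[/mapP[y /lx[_ xyE _] ->]//|/ssE//].
Qed.

End Greedy.

(** * Rainbow stars and small forests *)

Lemma seq_of_image (T : finType) (C : finType) (f : T -> C) (B : {set T}) k :
  k <= #|f @: B| ->
  exists l, [/\ uniq [seq f y | y <- l], size l = k & {subset l <= B}].
Proof.
elim: k => [|k IH] kB; first by exists [::].
have [l [ul szl lB]] := IH (ltnW kB).
have /subsetPn[_ /imsetP[y yB ->] fy] : ~~ (f @: B \subset [set x in [seq f y | y <- l]]).
  apply: contraL kB => /subset_leq_card le; rewrite -leqNgt (leq_trans le) // cardsE.
  by rewrite -szl -(size_map f) card_size.
exists (y :: l); split; first by rewrite /= ul andbT; move: fy; rewrite inE.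
  by rewrite /= szl.
by move=> z; rewrite inE => /orP[/eqP->|/lB].
Qed.

Section RainbowStar.

Variables (V C : finType) (c : {set V} -> C) (U : {set V}).

Let colors := c @: [set e : {set V} | e \subset U & #|e| == 2].
Let cols v := [set c [set v; y] | y in U :\ v].
Let seen x := [set v in U | x \in cols v].

Let sub_cols v : v \in U -> cols v \subset colors.
Proof.
move=> vU; apply/subsetP => _ /imsetP[y /setD1P[yv yU] ->].
apply/imsetP; exists [set v; y] => //; rewrite inE cards2 (eq_sym v) yv eqxx andbT.
by apply/subsetP => z; rewrite !inE => /orP[]/eqP->.
Qed.

Let sum_seen : \sum_(x in colors) #|seen x| = \sum_(v in U) #|cols v|.
Proof.
under eq_bigr => x _ do rewrite -sum1_card.
under eq_bigr => x _ do under eq_bigl do rewrite inE.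
rewrite (exchange_big_dep (mem U)) /=; last by move=> x v _ /andP[].
apply: eq_bigr => v vU; rewrite -sum1_card; apply: eq_bigl => x.
rewrite vU /=; case xv: (x \in cols v); rewrite ?andbF // andbT.
exact: (subsetP (sub_cols vU)).
Qed.

Let seen_ge2 x : x \in colors -> 1 < #|seen x|.
Proof.
case/imsetP => e; rewrite inE => /andP[eU /eqP e2] ->.
rewrite -e2; apply/subset_leq_card/subsetP => v ve.
rewrite inE (subsetP eU) //=.
have /eqP/cards2P[a [b [ab ee]]] := e2; subst e.
have [aU bU] : a \in U /\ b \in U by split; apply: (subsetP eU); rewrite !inE eqxx ?orbT.
move: ve; rewrite !inE => /orP[]/eqP->; apply/imsetP.
  by exists b => //; rewrite !inE eq_sym ab.
by exists a; rewrite 1?setUC // !inE ab.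
Qed.

(** [v] itself sees each of its own colors, and every other vertex [y] of [U] sees at least one of
    them, that of the edge [vy]. *)
Let sum_seen_at v : v \in U -> #|U|.-1 + #|cols v| <= \sum_(x in cols v) #|seen x|.
Proof.
move=> vU; have seenv x : x \in cols v -> #|seen x| = 1 + #|seen x :\ v|.
  by move=> xv; rewrite (cardsD1 v) inE vU xv.
rewrite (eq_bigr _ seenv) big_split /= sum1_card addnC leq_add2l.
have -> : #|U|.-1 = #|U :\ v| by rewrite (cardsD1 v U) vU.
rewrite -sum1_card; under [X in _ <= X]eq_bigr do rewrite -sum1_card.
rewrite (exchange_big_dep (mem (U :\ v))) /=; last first.
  by move=> x y _; rewrite !inE => /and3P[-> ->].
apply: leq_sum => y yU; have [yv yU'] := setD1P yU.
rewrite (bigD1 (c [set v; y])) //= imset_f //= !inE yv yU' /=.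
by rewrite setUC imset_f // !inE vU eq_sym yv.
Qed.

(* If every vertex sees at most q+1 colors, then a color z most frequent at some
   vertex is seen by at least q+2 vertices.  If all vertices see z, double
   counting the pairs (v, color seen at v) bounds the number of colors; otherwise
   the same follows from a vertex w missing z, whose own colors already reach all
   vertices, so that z contributes q+2 further pairs. *)
Lemma rainbow_star q :
  q.+1 ^ 2 < #|U| -> (q * #|U|)./2 + 1 < #|colors| ->
  exists x l, [/\ uniq (x :: l), size l = q.+2, {subset x :: l <= U} &
    uniq [seq c [set x; y] | y <- l]].
Proof.
move=> mbig Cbig; have [/existsP[x /andP[xU dx]]|] := boolP [exists x in U, q.+1 < #|cols x|].
  have [l [ul szl lU]] := seq_of_image dx; exists x, l; split=> //.
    rewrite /= (map_uniq ul) andbT; apply/negP => /lU.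
    by rewrite !inE eqxx.
  by move=> y; rewrite inE => /orP[/eqP->//|/lU/setD1P[]].
rewrite negb_exists_in => /forall_inP small; exfalso.
have {}small v : v \in U -> #|cols v| <= q.+1 by move/small; rewrite -leqNgt.
have [v0 v0U] : exists v, v \in U by apply/set0Pn; rewrite -card_gt0; apply: leq_trans mbig.
have total : \sum_(x in colors) #|seen x| <= q.+1 * #|U|.
  by rewrite sum_seen mulnC -sum_nat_const; apply: leq_sum.
(* Otherwise [sum_seen_at] gives [#|U| - 1 <= q * #|cols v0| <= q * q.+1], against
   [q.+1 ^ 2 < #|U|]. *)
have [z zv zbig] : exists2 z, z \in cols v0 & q.+1 < #|seen z|.
  apply/exists_inP; rewrite -[X in is_true X]negbK negb_exists_in; apply/negP => /forall_inP le.
  have := sum_seen_at v0U; have : \sum_(x in cols v0) #|seen x| <= #|cols v0| * q.+1.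
    by rewrite -sum_nat_const; apply: leq_sum => x /le; rewrite -leqNgt.
  by have := small _ v0U; nia.
have zC : z \in colors by apply: (subsetP (sub_cols v0U)).
have [Uz|/subsetPn[w wU wz]] := boolP (U \subset seen z).
  have : #|U| + 2 * #|colors|.-1 <= \sum_(x in colors) #|seen x|.
    rewrite (bigD1 z) //= leq_add ?subset_leq_card //.
    have -> : #|colors|.-1 = #|colors :\ z| by rewrite (cardsD1 z colors) zC.
    rewrite mulnC -sum_nat_const; under [X in _ <= X]eq_bigl do rewrite andbC -in_setD1.
    by apply: leq_sum => x /setD1P[_ /seen_ge2].
  by lia.
have zw : z \notin cols w by apply: contra wz => zw; rewrite inE wU.
have : #|U|.-1 + #|cols w| + (#|seen z| + 2 * (#|colors| - #|cols w|).-1)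
       <= \sum_(x in colors) #|seen x|.
  rewrite (big_setID (cols w)) /= (setIidPr (sub_cols wU)) leq_add ?sum_seen_at //.
  have zD : z \in colors :\: cols w by rewrite inE zw zC.
  rewrite (bigD1 z) //= leq_add2l.
  have -> : (#|colors| - #|cols w|).-1 = #|(colors :\: cols w) :\ z|.
    have := cardsD1 z (colors :\: cols w); rewrite zD.
    by rewrite cardsD (setIidPr (sub_cols wU)) => ->.
  rewrite mulnC -sum_nat_const; under [X in _ <= X]eq_bigl do rewrite andbC -in_setD1.
  by apply: leq_sum => x /setD1P[_ /setDP[/seen_ge2]].
(* With [#|cols w| <= q.+1] the inequality yields [2 * #|colors| <= q * #|U| + 2], against the
   assumed number of colors. *)
have := small _ wU; have := subset_leq_card (sub_cols wU).
by lia.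
Qed.

End RainbowStar.

(** * Two-star forests from two or three colors *)

Lemma fresh_seq (V : finType) (U : {set V}) (s : seq V) k :
  size s + k <= #|U| -> uniq s ->
  exists l, [/\ uniq (l ++ s), size l = k & {subset l <= U}].
Proof.
move=> le us; have [|l [ul szl lU]] := @subset_seq _ (U :\: [set y in s]) k.
  have := cardsID [set y in s] U; have := subset_leq_card (subsetIr U [set y in s]).
  have : #|[set y in s]| <= size s by rewrite cardsE card_size.
  by lia.
exists l; split=> // [|y /lU]; last by case/setDP.
rewrite cat_uniq ul us andbT; apply/hasPn => y ys.
by apply/negP => /lU; rewrite !inE ys.
Qed.

(** Lets a forest be picked from a list of distinct vertices by numerical indices, so that its
    disjointness is decided by computation. *)
Lemma uniq_map_nth (T : eqType) z (s : seq T) (idx : seq nat) :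
  uniq s -> uniq idx -> all (gtn (size s)) idx -> uniq [seq nth z s i | i <- idx].
Proof.
move=> us ui /allP lt; rewrite map_inj_in_uniq // => i j /lt si /lt sj /eqP.
by rewrite nth_uniq // => /eqP.
Qed.

Lemma sub_map_nth (T : eqType) z (s : seq T) (idx : seq nat) :
  all (gtn (size s)) idx -> {subset [seq nth z s i | i <- idx] <= s}.
Proof. by move=> /allP lt _ /mapP[i /lt si ->]; apply: mem_nth. Qed.

Section SmallForests.

Variables (V C : finType) (c : {set V} -> C) (U : {set V}).

Let colors := c @: [set e : {set V} | e \subset U & #|e| == 2].
Let k u w := c [set u; w].
Let kC u w : k u w = k w u. Proof. by rewrite /k setUC. Qed.

(** This is [rainbow_star] for [q = 0]. *)
Lemma rainbow_cherry :
  1 < #|U| -> 1 < #|colors| ->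
  exists x a b, [/\ uniq [:: x; a; b], {subset [:: x; a; b] <= U} & k x a != k x b].
Proof.
move=> U1 C1; have [||x [l [uxl szl lU ul]]] := @rainbow_star V C c U 0 => //.
case: l szl uxl lU ul => [|a [|b []]] // _ uxl lU ul.
by exists x, a, b; split=> //; move: ul; rewrite /= inE andbT.
Qed.

Let fresh_in (s : seq V) j : size s + j <= #|U| -> uniq s -> {subset s <= U} ->
  exists l, [/\ uniq (l ++ s), size l = j & {subset l ++ s <= U}].
Proof.
move=> le us sU; have [l [ul szl lU]] := fresh_seq le us.
by exists l; split=> // y; rewrite mem_cat => /orP[/lU|/sU].
Qed.

(** An edge [de] disjoint from a rainbow cherry at [x] differs in color from [xa] or from [xb]. *)
Lemma rainbow_matching2 :
  4 < #|U| -> 1 < #|colors| ->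
  exists ss, [/\ fsizes ss = [:: 1; 1], uniq (fverts ss),
    {subset fverts ss <= U} & uniq [seq c e | e <- fedges ss]].
Proof.
move=> U5 C1; have [|//|x [a [b [u3 sU kab]]]] := rainbow_cherry; first exact: leq_trans U5.
have [l [ul szl lU]] := @fresh_in [:: x; a; b] 2 U5 u3 sU.
  case: l szl ul lU => [|d [|e []]] // _ ud dU.
have win i : uniq [:: 2; i; 0; 1] -> all (gtn 5) [:: 2; i; 0; 1] ->
    k x (nth x [:: d; e; x; a; b] i) != k d e -> exists ss, [/\ fsizes ss = [:: 1; 1],
      uniq (fverts ss), {subset fverts ss <= U} & uniq [seq c e | e <- fedges ss]].
  move=> ui si kk; exists [:: (x, [:: nth x [:: d; e; x; a; b] i]); (d, [:: e])].
  split=> //; first exact: (uniq_map_nth x ud ui).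
    by move=> y yi; apply: dU; exact: (@sub_map_nth _ x [:: d; e; x; a; b] _ si y yi).
  by rewrite /= inE andbT.
have [eqk|nek] := eqVneq (k x a) (k d e); last exact: (win 3).
by apply: (win 4) => //=; rewrite -eqk eq_sym.
Qed.

(** Take a rainbow cherry and an edge of a third color. If they are disjoint, they are the forest;
    otherwise they form a rainbow three-edge star, triangle or path, and each of these yields the
    forest with the help of two or three fresh vertices. *)
Lemma rainbow_cherry_edge :
  6 < #|U| -> 2 < #|colors| ->
  exists ss, [/\ fsizes ss = [:: 2; 1], uniq (fverts ss),
    {subset fverts ss <= U} & uniq [seq c e | e <- fedges ss]].
Proof.
move=> U7 C2; set goal := (exists ss, _).
have [||x [a [b [u3 sU kab]]]] := rainbow_cherry; [exact: leq_trans U7|exact: leq_trans C2|].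
pose v L i := nth x L i.
(* [i0] is the centre of the cherry, [i1] and [i2] are its leaves, [i3] and [i4] the ends of the
   single edge. *)
have win L i0 i1 i2 i3 i4 : uniq L -> {subset L <= U} ->
    uniq [:: i0; i1; i2; i3; i4] -> all (gtn (size L)) [:: i0; i1; i2; i3; i4] ->
    k (v L i0) (v L i1) != k (v L i0) (v L i2) ->
    k (v L i0) (v L i1) != k (v L i3) (v L i4) ->
    k (v L i0) (v L i2) != k (v L i3) (v L i4) -> goal.
  move=> uL sL ui si k1 k2 k3.
  exists [:: (v L i0, [:: v L i1; v L i2]); (v L i3, [:: v L i4])]; split=> //.
  - exact: (uniq_map_nth x uL ui).
  - by move=> y yi; apply: sL; exact: (@sub_map_nth _ x L _ si y yi).
  by rewrite /= !inE negb_or k1 k2 k3.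
(* At most one edge of the rainbow star has the color of the fresh edge [de]; two others form a
   cherry that goes with [de]. The triangle below is treated alike. *)
have star3 w : uniq [:: x; a; b; w] -> w \in U -> k x a != k x w -> k x b != k x w -> goal.
  move=> u4 wU k1 k2; have s4 : {subset [:: x; a; b; w] <= U}.
    by move=> y; rewrite (mem_cat y [:: x; a; b] [:: w]) mem_seq1 => /orP[/sU|/eqP->].
  have [l [ul szl lU]] := @fresh_in [:: x; a; b; w] 2 (ltnW U7) u4 s4.
  case: l szl ul lU => [|d [|e []]] // _ ud dU.
  have [e1|n1] := eqVneq (k d e) (k x a).
    by apply: (win _ 2 4 5 0 1 ud dU) => //; rewrite /v /= e1 eq_sym.
  have [e2|n2] := eqVneq (k d e) (k x b).
    by apply: (win _ 2 3 5 0 1 ud dU) => //; rewrite /v /= e2 // eq_sym.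
  by apply: (win _ 2 3 4 0 1 ud dU) => //; rewrite /v /= eq_sym.
have tri : k x a != k a b -> k x b != k a b -> goal.
  move=> k1 k2; have [l [ul szl lU]] := @fresh_in [:: x; a; b] 2 (ltnW (ltnW U7)) u3 sU.
  case: l szl ul lU => [|d [|e []]] // _ ud dU.
  have [e1|n1] := eqVneq (k d e) (k x a).
    by apply: (win _ 4 2 3 0 1 ud dU) => //; rewrite /v /= ?e1 ?(kC b x) ?(kC b a) // eq_sym.
  have [e2|n2] := eqVneq (k d e) (k x b).
    by apply: (win _ 3 2 4 0 1 ud dU) => //; rewrite /v /= ?e2 ?(kC a x) // eq_sym.
  by apply: (win _ 2 3 4 0 1 ud dU) => //; rewrite /v /= eq_sym.
(* the path b0 - x - a0 - y *)
have path3 a0 b0 y : uniq [:: x; a0; b0; y] -> {subset [:: x; a0; b0; y] <= U} ->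
    k x a0 != k x b0 -> k x a0 != k a0 y -> k x b0 != k a0 y -> goal.
  move=> u4 s4 k12 k13 k23.
  have [l [ul szl lU]] := @fresh_in [:: x; a0; b0; y] 3 U7 u4 s4.
  case: l szl ul lU => [|d [|e [|f []]]] // _ ud dU.
  (* Both cherries of the path contain its middle edge, so a fresh edge whose color differs from
     that of [x a0] goes with one of them. *)
  have inner i j : uniq [:: 4; 3; 6; i; j] -> uniq [:: 3; 4; 5; i; j] -> all (gtn 7) [:: i; j] ->
      k (v [:: d, e, f & [:: x; a0; b0; y]] i) (v [:: d, e, f & [:: x; a0; b0; y]] j) != k x a0 -> goal.
    set L := [:: d, e, f & _] => ui ui' si kij.
    have [e2|n2] := eqVneq (k (v L i) (v L j)) (k x b0).
      apply: (win L 4 3 6 i j ud dU) => //; last first.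
      - by rewrite e2 eq_sym.
      - by rewrite (kC _ (v L 3)) eq_sym.
      - by rewrite (kC _ (v L 3)).
    apply: (win L 3 4 5 i j ud dU) => //; last by rewrite eq_sym.
    by rewrite eq_sym.
  have [de|n] := eqVneq (k d e) (k x a0); last exact: (inner 0 1).
  have [ef|n'] := eqVneq (k e f) (k x a0); last exact: (inner 1 2).
  (* Now [ef] has the color of the middle edge. The edge [b0 d] either forms a cherry with [x b0],
     completed by [a0 y] or by [ef], or completes the cherry at [a0]. *)
  have [e1|n1] := eqVneq (k b0 d) (k x a0).
    by apply: (win _ 5 3 0 4 6 ud dU) => //; rewrite /v /= ?e1 ?(kC b0 x) // eq_sym.
  have [e2|n2] := eqVneq (k b0 d) (k a0 y).
    by apply: (win _ 5 3 0 1 2 ud dU) => //; rewrite /v /= ?e2 ?ef ?(kC b0 x) // eq_sym.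
  by apply: (win _ 4 3 6 5 0 ud dU) => //; rewrite /v /= ?(kC a0 x) // eq_sym.
have [kz [/imsetP[e]]] : exists kz, kz \in colors /\ (kz != k x a) && (kz != k x b).
  have /subsetPn[kz kzc] : ~~ (colors \subset [set k x a; k x b]).
    apply: contraL C2 => /subset_leq_card le.
    by rewrite -leqNgt (leq_trans le) // cards2; case: eqVneq.
  by rewrite !inE negb_or; exists kz.
rewrite inE => /andP[eU /cards2P[u [w [uw ee]]]] ->; subst e => /andP[ka kb].
have [uU wU] : u \in U /\ w \in U by split; apply: (subsetP eU); rewrite !inE eqxx ?orbT.
rewrite -/(k u w) in ka kb.
(* The end [u'] decides the shape: a star if it is [x]; otherwise a triangle if [w'] is the other
   leaf, and a path if not. *)
have key u' w' : u' \in U -> w' \in U -> u' != w' -> k u' w' != k x a -> k u' w' != k x b ->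
    u' \in [:: x; a; b] -> goal.
  move=> u'U w'U uw' ka' kb'; move: u3; rewrite /= !inE negb_or andbT => /andP[/andP[xa xb] ab].
  have [xU aU bU] : [/\ x \in U, a \in U & b \in U].
    by split; apply: sU; rewrite !inE eqxx ?orbT.
  case/or3P => /eqP uE; move: uw' ka' kb'; rewrite {}uE => uw' ka' kb'.
  - apply: (star3 w') => //; try by rewrite eq_sym.
    rewrite /= !inE !negb_or xa xb ab uw' !andbT /=.
    by rewrite -(negb_or (a == w')); apply/norP; split; apply/eqP => aw; move: ka' kb'; rewrite aw eqxx.
  - have [wx|wx] := eqVneq w' x; first by move: ka'; rewrite wx kC eqxx.
    have [wb|wb] := eqVneq w' b; first by move: ka' kb'; rewrite wb => ? ?; apply: tri; rewrite eq_sym.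
    apply: (path3 a b w') => //; try by rewrite eq_sym.
      by rewrite /= !inE !negb_or xa xb ab uw' !(eq_sym _ w') wx wb.
    by move=> z; rewrite !inE => /or4P[] /eqP->.
  - have [wx|wx] := eqVneq w' x; first by move: kb'; rewrite wx kC eqxx.
    have [wa|wa] := eqVneq w' a.
      by move: ka' kb'; rewrite wa (kC b a) => ? ?; apply: tri; rewrite eq_sym.
    apply: (path3 b a w') => //; try by rewrite eq_sym.
      by rewrite /= !inE !negb_or xa xb (eq_sym b a) ab uw' !(eq_sym _ w') wx wa.
    by move=> z; rewrite !inE => /or4P[] /eqP->.
have [ui|nu] := boolP (u \in [:: x; a; b]); first exact: (key u w).
have [wi|nw] := boolP (w \in [:: x; a; b]).
  by apply: (key w u) => //; rewrite ?(kC w) // eq_sym.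
apply: (win [:: u, w & [:: x; a; b]] 2 3 4 0 1) => //; try by rewrite /v /= eq_sym.
- by rewrite (cons_uniq u) (cons_uniq w) (in_cons w) negb_or uw nu nw.
- by move=> y; rewrite (in_cons u) (in_cons w) => /or3P[/eqP->|/eqP->|/sU].
Qed.
End SmallForests.

(** * Upper bound *)

(** As [c] is injective on [F], excluding a color of [s] removes at most one edge. *)
Lemma card_recolor (V C : finType) (c : {set V} -> C) (F : {set {set V}}) (s : seq C) :
  {in F &, injective c} -> #|F| <= #|[set e in F | c e \notin s]| + size s.
Proof.
move=> cinj; rewrite -(cardsID [set e : {set V} | c e \in s]) addnC leq_add //.
  by apply/subset_leq_card/subsetP => e; rewrite !inE andbC.
rewrite -(card_in_imset (f := c)); last first.
  by move=> e f /setIP[eF _] /setIP[fF _]; apply: cinj.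
apply: leq_trans (card_size s); apply: subset_leq_card.
by apply/subsetP => _ /imsetP[e /setIP[_]] /[!inE] es ->.
Qed.

Lemma card_nbr_recolor (V C : finType) (c : {set V} -> C) (G : {set {set V}})
    (s : seq C) (v : V) :
  {in G, forall e : {set V}, #|e| = 2} -> {in G &, injective c} ->
  #|nbr G v| <= #|nbr [set e in G | c e \notin s] v| + size s.
Proof.
move=> G2 cinj; rewrite !card_nbr // => [|e /setIdP[/G2]//].
apply: leq_trans (card_recolor s _) _.
  by move=> e f /setIdP[eG _] /setIdP[fG _]; apply: cinj.
rewrite leq_add2r; apply/subset_leq_card/subsetP => e; rewrite !inE.
by rewrite -!andbA [(c e \notin s) && _]andbC.
Qed.

Lemma sumn_le (s : seq nat) m : {in s, forall k, k <= m} -> sumn s <= size s * m.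
Proof.
elim: s => //= k s IH le; rewrite mulSn leq_add ?le ?mem_head // IH // => j js.
by rewrite le // inE js orbT.
Qed.

(** The product [#|A| * #|V|] counts each pair inside [A] twice and each vertex of [A] once as a
    loop, an excess of ['C(#|A|, 2) + #|A|]. *)
Lemma card_edges_meeting (V : finType) (A : {set V}) :
  #|[set e : {set V} | (#|e| == 2) && ~~ [disjoint e & A]]| + 'C(#|A|.+1, 2)
  = #|A| * #|V|.
Proof.
have tot : #|[set e : {set V} | #|e| == 2]| = 'C(#|V|, 2).
  by rewrite -cardsT -cards_draws; apply: eq_card => e; rewrite !inE subsetT.
have := cards_draws (~: A) 2; have := cardsC A.
set m := #|~: A|; set h := #|A| => hm dis.
have := cardsID [set e : {set V} | [disjoint e & A]] [set e : {set V} | #|e| == 2].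
rewrite tot.
have -> : #|[set e : {set V} | #|e| == 2] :&: [set e : {set V} | [disjoint e & A]]| = 'C(m, 2).
  by rewrite -dis; apply: eq_card => e; rewrite !inE disjoints_subset andbC.
have -> : [set e : {set V} | #|e| == 2] :\: [set e : {set V} | [disjoint e & A]]
    = [set e : {set V} | (#|e| == 2) && ~~ [disjoint e & A]].
  by apply/setP => e; rewrite !inE andbC.
rewrite -hm; have : 'C(h + m, 2) + 'C(h.+1, 2) = 'C(m, 2) + h * (h + m).
  elim: h {hm} => [|h IH]; first by rewrite add0n addn0.
  by rewrite addSn [X in X + _]binS bin1 (binS h.+1) bin1; nia.
by lia.
Qed.

(** * Numerical estimates for the greedy choice *)

Lemma bin2D_le a b : 'C(a + b, 2) <= 'C(a, 2) + b * (a + b).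
Proof.
elim: b => [|b IH]; first by rewrite addn0 leq_addr.
by rewrite addnS binS bin1; nia.
Qed.

(* With P = p 1 + 1 and D = t P + p 1, the vertices outside the high-degree set
   have degree at most D - 1 and at most (t - 1) P vertices are in use when the
   last star is chosen, so at most (D - 1) (t - 1) P edges get lost. *)
Lemma loss_bound t P n : 2 <= t -> 3 <= P -> 3 * t ^ 2 * P ^ 2 <= n ->
  2 * ((t * P + P.-1).-1 * (t.-1 * P)) + t * P + 2 * P < n.
Proof.
move=> t2 P3; apply: leq_trans; case: t t2 => [|[|t]] // _; case: P P3 => // P P3.
by rewrite /= -!mulnn; nia.
Qed.

(* In the three slack lemmas, G counts all edges of the representing graph, g
   those avoiding the h vertices of high degree, b is 'C(h.+1, 2), X is the
   number of lost edges and q is a star size. *)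
Lemma edge_slack_next n h q X Y P g G b :
  h.+1 * q <= Y -> 2 * X + Y + 2 * P.+1 < n -> 1 < q ->
  G + b <= g + h * n ->
  h.+1 * n + ((q - 2) * (n - h.+1))./2 + 1 < G + (b + h.+1) ->
  q.-1 * n + 2 * X + 2 * P < 2 * g.
Proof.
case: q => [|[|q]] // hq nbig _; rewrite !subSS subn0 /=.
have [m nE] : exists m, n = h.+1 + m by exists (n - h.+1); nia.
by subst n; rewrite addKn; nia.
Qed.

(** For later stars of size 1: as [q] is at least 3, the star bound exceeds the multiples of [n] due
    to the [h] vertices by about n / 2, which covers the losses. *)
Lemma edge_slack_first n h q X Y P g G b :
  h * q <= Y -> 2 * X + Y + 2 * P.+1 < n -> 2 < q ->
  G + b <= g + h * n ->
  h * n + ((q - 2) * (n - h))./2 + 1 < G + b ->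
  0 * n + 2 * X + 2 * P < 2 * g.
Proof.
case: q => [|[|[|q]]] // hq nbig _; rewrite !subSS subn0 /=.
have [m nE] : exists m, n = h + m by exists (n - h); nia.
by subst n; rewrite addKn; nia.
Qed.

(** With at least three stars left, the matching bound contains [t - 2 - h >= 1] more multiples of
    [n] than the edges meeting the [h] vertices can use up. *)
Lemma edge_slack_matching n t h X Y P g G b r b' :
  3 * t <= Y -> 2 * X + Y + 2 * P.+1 < n -> h.+2 < t ->
  (t - 2) * n + r < G + b' -> G + b <= g + h * n ->
  b' <= b + (t - 2 - h) * t.-1 ->
  0 * n + 2 * X + 2 * P < 2 * g.
Proof.
move=> tY nbig ht; have [u tE] : exists u, t = h + u + 3 by exists (t - h - 3); lia.
subst t; have -> : h + u + 3 - 2 - h = u.+1 by lia.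
have -> : h + u + 3 - 2 = h + u + 1 by lia.
have -> : (h + u + 3).-1 = h + u + 2 by lia.
by nia.
Qed.

(** * Assembling a rainbow copy *)

Section Upper.

Variables (n t : nat) (p : nat -> nat) (C : finType) (c : {set 'I_n} -> C).
Variable G : {set {set 'I_n}}.

Let D := t * (p 1).+1 + p 1.

Hypothesis p_mono : forall i j, 0 < i -> i <= j -> j <= t -> p j <= p i.
Hypothesis G2 : {in G, forall e : {set 'I_n}, #|e| = 2}.
Hypothesis cinj : {in G &, injective c}.

Let p_le i : 0 < i -> i <= t -> p i <= p 1. Proof. exact: p_mono. Qed.

(** [T] is rainbow but need not lie in [G]; [R] lies in [G] and avoids the colors of [T]. The first
    stars are added last, centred at [hs], whose degrees survive the loss of the colors of [T]. *)
Lemma rainbow_extend (hs : seq 'I_n) (T R : seq ('I_n * seq 'I_n)) :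
  size hs <= t -> {in hs, forall x, D <= #|nbr G x|} ->
  fsizes T ++ fsizes R = [seq p i.+1 | i <- iota (size hs) (t - size hs)] ->
  uniq (hs ++ fverts T ++ fverts R) ->
  uniq [seq c e | e <- fedges T] -> size (fedges T) <= p 1 ->
  {subset fedges R <= [set e in G | c e \notin [seq c e | e <- fedges T]]} ->
  @has_rainbow (complete n) (star_forest t p) C c.
Proof.
move=> ht hsD sz uv uT szT RE; set E := [set e in G | _] in RE.
pose W := [set v in hs ++ fverts T ++ fverts R].
pose ks := [seq p i.+1 | i <- iota 0 (size hs)].
have E2 : {in E, forall e : {set 'I_n}, #|e| = 2} by move=> e /setIdP[/G2].
have [uhs] : uniq hs /\ uniq (fverts T ++ fverts R).
  by move: uv; rewrite cat_uniq => /and3P[].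
rewrite cat_uniq => /and3P[uvT _ uvR].
have [|||ssH [szH uH HW HE]] := @greedy_centers _ E hs ks W uhs.
- by move=> x xh; rewrite inE mem_cat xh.
- by rewrite size_map size_iota.
- move=> x xh; have := card_nbr_recolor [seq c e | e <- fedges T] x G2 cinj.
  rewrite -/E size_map => le; have := hsD x xh.
  (* This is where [D] comes from: [t * (p 1).+1] bounds the vertices of the whole forest, and [p 1]
     the edges lost to the colors of [T]. *)
  suff : #|W| + sumn ks <= t * (p 1).+1.
    move=> a b; apply: leq_trans a _; rewrite -(leq_add2r (p 1)).
    by apply: leq_trans b _; apply: leq_trans le _; rewrite leq_add2l.
  have Wle : #|W| <= size hs + sumn [seq k.+1 | k <- fsizes T ++ fsizes R].
    rewrite cardsE (leq_trans (card_size _)) // !size_cat !size_fverts.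
    by rewrite map_cat sumn_cat.
  rewrite sz in Wle.
  have small i m : i + m <= t -> {in [seq p j.+1 | j <- iota i m], forall k, k <= p 1}.
    by move=> im ? /mapP[j]; rewrite mem_iota => /andP[ij jm] ->; apply: p_le => //; lia.
  have := sumn_le (small 0 (size hs) ht); rewrite -/ks size_map size_iota.
  have : {in [seq k.+1 | k <- [seq p i.+1 | i <- iota (size hs) (t - size hs)]],
     forall k, k <= (p 1).+1}.
    by move=> ? /mapP[k /small kp ->]; rewrite ltnS; apply: kp; lia.
  by move/sumn_le; rewrite !size_map size_iota; nia.
have HW' v : v \in fverts ssH -> v \notin fverts T ++ fverts R.
  move/HW/orP => [vh|]; last by rewrite inE mem_cat negb_or => /andP[].
  by move: uv; rewrite cat_uniq => /and3P[_ /hasPn dis _]; apply: contraL vh => /dis.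
apply: (@rainbow_of_forest n t p C c (ssH ++ T ++ R)).
- rewrite !fverts_cat cat_uniq uH /=; apply/andP; split.
    by apply/hasPn => v vTR; apply: contraL vTR => /HW'.
  by move: uv; rewrite cat_uniq => /and3P[].
(* All edges other than those of [T] lie in [E], where [c] is injective and takes no color of
   [T]. *)
- rewrite !fedges_cat !map_cat uniq_catCA cat_uniq uT /=.
  have HRE : {subset fedges (ssH ++ R) <= E}.
    by move=> e; rewrite fedges_cat mem_cat => /orP[/HE|/RE].
  rewrite -map_cat -fedges_cat map_inj_in_uniq; last first.
    by move=> e f /HRE/setIdP[eG _] /HRE/setIdP[fG _]; apply: cinj.
  rewrite uniq_fedges ?andbT.
    by apply/hasPn => _ /mapP[e /HRE/setIdP[_ ce] ->].
  rewrite fverts_cat cat_uniq uH uvR andbT /=.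
  by apply/hasPn => v vR; apply/negP => /HW'; rewrite mem_cat vR orbT.
rewrite /fsizes !map_cat -!/(fsizes _) szH sz /ks -map_cat -{2}[size hs]add0n -iotaD.
by rewrite subnKC.
Qed.

Hypotheses (t_gt0 : 0 < t) (p1_ge3 : 2 < p 1) (pt_gt0 : 0 < p t).
Hypothesis n_large : 3 * t ^ 2 * (p 1).+1 ^ 2 <= n.
(** [G] has more edges than each term of the formula. Here [j] is i - 1, and the binomial is moved
    to the right to stay in the natural numbers. *)
Hypothesis card_star : forall j, j < t -> 1 < p j.+1 ->
  j * n + ((p j.+1 - 2) * (n - j))./2 + 1 < #|G| + 'C(j.+1, 2).
Hypothesis card_match : 1 < t ->
  (t - 2) * n + (if p t.-1 == 1 then 1 else 2) < #|G| + 'C(t.-1, 2).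

Let H := [set v | D <= #|nbr G v|].
Let U := ~: H.
Let G' := [set e in G | [disjoint e & H]].
Let colors := c @: [set e : {set 'I_n} | e \subset U & #|e| == 2].

Let cardG' : #|G| + 'C(#|H|.+1, 2) <= #|G'| + #|H| * n.
Proof.
have := card_edges_meeting H; rewrite card_ord => <-; rewrite addnA leq_add2r.
rewrite -(cardsID [set e : {set 'I_n} | [disjoint e & H]] G) leq_add //.
  by apply/subset_leq_card/subsetP => e; rewrite !inE.
by apply/subset_leq_card/subsetP => e; rewrite !inE => /andP[-> /G2->].
Qed.

Let cardU : #|U| = n - #|H|. Proof. by have := cardsC H; rewrite card_ord /U; lia. Qed.

Let colorsG' : #|G'| <= #|colors|.
Proof.
rewrite -(card_in_imset (f := c) (D := G')); last first.
  by move=> e f /setIdP[eG _] /setIdP[fG _]; apply: cinj.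
apply/subset_leq_card/imsetS/subsetP => e; rewrite !inE => /andP[eG dis].
by rewrite -disjoints_subset dis G2 /=.
Qed.

Let n_big : t * t + 3 * (p 1).+1 * (p 1).+1 <= n + 3.
Proof. by move: n_large; rewrite -!mulnn; nia. Qed.

(** With h = [#|H|], removing the edges that meet [H] leaves more than
    [((p h.+1 - 2) * (n - h))./2 + 1] colors inside [U], which has n - h vertices: just what
    [rainbow_star] asks for. A star of size 1 is any edge. *)
Lemma rainbow_seed : #|H| < t -> exists x l, [/\ uniq (x :: l), size l = p #|H|.+1,
  {subset x :: l <= U} & uniq [seq c [set x; y] | y <- l]].
Proof.
move=> Ht; have qP : p #|H|.+1 <= p 1 by apply: p_le.
have q1 : 0 < p #|H|.+1 by apply: leq_trans pt_gt0 (p_mono _ _ _).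
case E: (p #|H|.+1) => [|[|q]]; first by rewrite E in q1.
  have [|l [ul szl lU]] := @subset_seq _ U 2; first by rewrite cardU; move: Ht n_big (leq_pmulr t t_gt0); clear -p1_ge3; nia.
  by case: l szl ul lU => [|x [|y []]] // _ ul lU; exists x, [:: y].
have := card_star Ht; rewrite E subSS subSS subn0 => /(_ isT) cs.
apply: rainbow_star; rewrite -/colors cardU; last first.
  by apply: leq_trans colorsG'; move: cs cardG'; clear; lia.
have qq : q.+1 * q.+1 <= p 1 * p 1 by apply: leq_mul; rewrite ltnW // -E.
move: qq Ht n_big (leq_pmulr t t_gt0); rewrite -mulnn; clear; set h := #|H|.
by lia.
Qed.

Lemma rainbow_upper : @has_rainbow (complete n) (star_forest t p) C c.
Proof.
have [tH|Ht] := leqP t #|H|.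
  apply: (@rainbow_extend (take t (enum H)) [::] [::]) => //.
  - by rewrite size_takel // -cardE.
  - by move=> x /mem_take; rewrite mem_enum inE.
  - by rewrite size_takel -?cardE // subnn.
  by rewrite cats0 take_uniq ?enum_uniq.
have hsD : {in enum H, forall x, D <= #|nbr G x|} by move=> x; rewrite mem_enum inE.
have uHU s : uniq s -> {subset s <= U} -> uniq (enum H ++ s).
  move=> us sU; rewrite cat_uniq enum_uniq us andbT; apply/hasPn => x /sU.
  by rewrite inE mem_enum.
have szH : size (enum H) = #|H| by rewrite -cardE.
have [x [l [uxl szl xlU cl]]] := rainbow_seed Ht.
have qP : p #|H|.+1 <= p 1 by apply: p_le.
have seed1 : fedges [:: (x, l)] = [seq [set x; y] | y <- l] by rewrite /fedges /= cats0.
have seed2 : fverts [:: (x, l)] = x :: l by rewrite /fverts /= cats0.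
have [eqt|Ht2] := leqP t #|H|.+1.
  apply: (@rainbow_extend (enum H) [:: (x, l)] [::]) => //; rewrite ?szH ?(ltnW Ht) ?seed1 ?seed2 //.
  - have -> : t - #|H| = 1 by lia.
    by rewrite /= szl.
  - by have := uHU _ uxl xlU; rewrite -{1}[x :: l]cats0.
  - by rewrite -map_comp.
  by rewrite size_map szl.
have cm := card_match (leq_ltn_trans (ltn0Sn _) Ht2).
have q2_gt0 : 0 < p #|H|.+2 by apply: leq_trans pt_gt0 (p_mono _ _ _).
have q2q : p #|H|.+2 <= p #|H|.+1 by apply: p_mono.
have small (T : seq ('I_n * seq 'I_n)) : #|H|.+2 = t ->
    fsizes T = [:: p #|H|.+1; p #|H|.+2] -> size (fedges T) <= p 1 ->
    uniq (fverts T) -> {subset fverts T <= U} -> uniq [seq c e | e <- fedges T] ->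
    @has_rainbow (complete n) (star_forest t p) C c.
  move=> eqt szT szT' uT TU cT.
  apply: (@rainbow_extend (enum H) T [::]) => //; rewrite ?szH ?(ltnW Ht) //.
  - have -> : t - #|H| = 2 by lia.
    by rewrite /= szT.
  - by have := uHU _ uT TU; rewrite -{1}[fverts T]cats0.
(* The stars after the seed are chosen greedily in [G'], without the colors of the seed. *)
have large : (p #|H|.+2).-1 * n + 2 * (D.-1 * (t.-1 * (p 1).+1)) + 2 * p 1 < 2 * #|G'| ->
    @has_rainbow (complete n) (star_forest t p) C c.
  move=> big; pose E0 := [set e in G' | c e \notin [seq c e | e <- fedges [:: (x, l)]]].
  have G'inj : {in G' &, injective c} by move=> e f /setIdP[eG _] /setIdP[fG _]; apply: cinj.
  have E02 : {in E0, forall e : {set 'I_n}, #|e| = 2}.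
    by move=> e /setIdP[/setIdP[/G2]].
  (* Vertices of [H] lie on no edge of [G']; the others have degree below [D]. *)
  have maxdeg v : #|nbr E0 v| <= D.-1.
    have [vH|vH] := boolP (v \in H).
      rewrite (_ : nbr E0 v = set0) ?cards0 //; apply/setP => y; rewrite !inE.
      apply/negP => /and3P[_ /andP[_ dis] _].
      by have := disjointFl dis vH; rewrite !inE eqxx.
    have : #|nbr G v| < D by move: vH; rewrite inE -ltnNge.
    suff : #|nbr E0 v| <= #|nbr G v| by move=> a b; rewrite -ltnS prednK; first exact: leq_ltn_trans a b; lia.
    by apply/subset_leq_card/subsetP => y; rewrite !inE => /and3P[-> /andP[->]].
  have cE0 := card_recolor [seq c e | e <- fedges [:: (x, l)]] G'inj.
  rewrite -/E0 size_map seed1 size_map szl in cE0.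
  pose ks := [seq p i.+1 | i <- iota #|H|.+1 (t - #|H|.+1)].
  pose S := [set y in enum H ++ x :: l].
  have Sle : #|S| <= #|H| + (p #|H|.+1).+1.
    rewrite cardsE (leq_trans (card_size _)) // size_cat szH /= szl.
    by [].
  have [|| ss [szss uss ssS ssE]] := @greedy_free _ E0 D.-1 E02 maxdeg (p #|H|.+2).-1 ks S.
  - move=> k /mapP[j]; rewrite mem_iota => /andP[j1 j2] ->; rewrite prednK //.
    by apply: p_mono => //; lia.
  - rewrite card_ord size_map size_iota.
    (* Blocked are the h vertices of [H], the seed, and the t - h - 2 stars before the last; this
       makes t - 1 blocks of at most [(p 1).+1] vertices. *)
    have : #|S| + (t - #|H|.+1).-1 * (p #|H|.+2).-1.+2 <= t.-1 * (p 1).+1.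
      apply: leq_trans (leq_add Sle (leqnn _)) _.
      have -> : t.-1 = #|H| + (t - #|H|.+1).-1.+1 by lia.
      by move: Ht2 qP q2q q2_gt0 p1_ge3; clear; nia.
    move=> /(leq_mul (leqnn D.-1)) le.
    by move: big cE0 le qP; set X := D.-1 * _; set Y := D.-1 * _; lia.
  apply: (@rainbow_extend (enum H) [:: (x, l)] ss) => //; rewrite ?szH ?(ltnW Ht) ?seed1 ?seed2 //.
  - have -> : t - #|H| = (t - #|H|.+1).+1 by lia.
    by rewrite /= szl -/(fsizes _) szss.
  - rewrite catA cat_uniq uss (uHU _ uxl xlU) andbT /=; apply/hasPn => v /ssS.
    by rewrite inE.
  - by rewrite -map_comp.
  - by rewrite size_map szl.
  by move=> e /ssE; rewrite -seed1 !inE => /andP[/andP[-> _] ->].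
have loss : 2 * (D.-1 * (t.-1 * (p 1).+1)) + t * (p 1).+1 + 2 * (p 1).+1 < n.
  have P3 : 2 < (p 1).+1 by lia.
  have := loss_bound (leq_ltn_trans (ltn0Sn _) Ht2) P3 n_large.
  by rewrite [_.+1.-1]/=.
(* If the second remaining star has at least 2 edges, the star bound at index h + 2 supplies enough
   edges. *)
have [q2_1|q2_ge2] := leqP (p #|H|.+2) 1; last first.
  apply: large; have := card_star Ht2 q2_ge2; move: cardG'.
  rewrite (binS #|H|.+1 1) bin1.
  have hq : #|H|.+1 * p #|H|.+2 <= t * (p 1).+1 by apply: leq_mul; lia.
  exact: (edge_slack_next hq loss q2_ge2).
have {}q2_1 : p #|H|.+2 = 1 by lia.
have [q3|q_le2] := ltnP 2 (p #|H|.+1).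
  apply: large; have := card_star Ht (ltnW q3); move: cardG'.
  have hq : #|H| * p #|H|.+1 <= t * (p 1).+1 by apply: leq_mul; lia.
  rewrite q2_1; exact: (edge_slack_first hq loss q3).
have [t3|t_le2] := ltnP #|H|.+2 t.
  apply: large; have := bin2D_le #|H|.+1 (t - 2 - #|H|).
  have -> : #|H|.+1 + (t - 2 - #|H|) = t.-1 by lia.
  rewrite q2_1; have tP : 3 * t <= t * (p 1).+1 by rewrite mulnC leq_mul2l; lia.
  move: cm cardG'; exact: (edge_slack_matching tP loss t3).
have {t_le2}eqt : #|H|.+2 = t by lia.
have U_big : 6 < #|U| by rewrite cardU; move: Ht n_big (leq_pmulr t t_gt0); clear -p1_ge3; nia.
have tp : t.-1 = #|H|.+1 by lia.
have t2 : t - 2 = #|H| by lia.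
have q1 : 0 < p #|H|.+1 by apply: leq_trans q2q.
(* Together with [cardG'], [cm] says that [G'] has at least two edges for sizes (1, 1) and three for
   (2, 1), and as many colors occur in [U]. *)
rewrite tp t2 in cm; have G'c := leq_trans _ colorsG'.
have [q_1|q_2] : p #|H|.+1 = 1 \/ p #|H|.+1 = 2 by lia.
  have [||T [szT uT TU cT]] := @rainbow_matching2 _ _ c U; first exact: ltnW (ltnW U_big).
    by apply: G'c; move: cm cardG'; rewrite q_1 eqxx; lia.
  apply: (small T) => //; first by rewrite szT q_1 q2_1.
  by rewrite size_fedges szT; apply: leq_trans p1_ge3.
have [//||T [szT uT TU cT]] := @rainbow_cherry_edge _ _ c U.
  by apply: G'c; move: cm cardG'; rewrite q_2 /=; lia.
apply: (small T) => //; first by rewrite szT q_2 q2_1.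
by rewrite size_fedges szT; apply: leq_trans p1_ge3.
Qed.

End Upper.

(** * Lower bound *)

(** Provides the edges outside [A] in the construction for the star bound. *)
Lemma near_regular (V : finType) (U : {set V}) k : k < #|U| ->
  exists R : {set {set V}},
    [/\ {in R, forall e : {set V}, #|e| = 2 /\ e \subset U},
        #|R| = (k * #|U|)./2 & forall v, #|nbr R v| <= k].
Proof.
set m := #|U| => km; have [v0 _] : exists v, v \in U.
  by apply/set0Pn; rewrite -card_gt0; apply: leq_ltn_trans km.
pose g i := nth v0 (enum U) i.
have gU i : i < m -> g i \in U by move=> im; rewrite -mem_enum mem_nth // -cardE.
have gI i j : i < m -> j < m -> g i = g j -> i = j.
  by move=> im jm /eqP; rewrite nth_uniq ?enum_uniq -?cardE // => /eqP.
(* A circulant graph with differences 1, ..., k./2, plus a near-perfect matching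
   of difference m./2 when k is odd. *)
pose sh z := if z < m then z else z - m.
pose Ix := [seq (x, d) | x <- iota 0 m, d <- iota 1 k./2] ++
  (if odd k then [seq (x, m./2) | x <- iota 0 m./2] else [::]).
(* A pair (x, d) stands for the edge joining positions x and x + d modulo [m]; [sh] does the
   reduction. *)
pose ed (z : nat * nat) := [set g z.1; g (sh (z.1 + z.2))].
have IxP z : z \in Ix -> z.1 < m /\ ((0 < z.2 <= k./2) || odd k && (z.2 == m./2) && (z.1 < m./2)).
  rewrite mem_cat => /orP[/allpairsP[[x d] [/= xm dk ->]]|].
    by move: xm dk; rewrite !mem_iota /=; lia.
  by case: ifP => // ok /mapP[x xm ->] /=; move: xm; rewrite mem_iota eqxx; lia.
have uIx : uniq Ix.
  rewrite cat_uniq allpairs_uniq ?iota_uniq //=; last by move=> [? ?] [? ?].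
  case: ifP => //= ok; rewrite map_inj_uniq ?iota_uniq ?andbT //; last by move=> ? ? [].
  apply/hasPn => _ /mapP[x xm ->]; apply/negP => /allpairsP[[x' d] [/= _ dk [_ e]]].
  by move: dk; rewrite mem_iota -e; lia.
have shm z : z.1 < m -> z.2 < m -> sh (z.1 + z.2) < m.
  by rewrite /sh; case: ifP; lia.
have z2m z : z \in Ix -> z.2 < m by move/IxP; lia.
have pairE a b a' b' : a < m -> b < m -> a' < m -> b' < m ->
    [set g a; g b] = [set g a'; g b'] -> (a = a' /\ b = b') \/ (a = b' /\ b = a').
  move=> am bm am' bm' E.
  have : g a \in [set g a'; g b'] by rewrite -E !inE eqxx.
  have : g b \in [set g a'; g b'] by rewrite -E !inE eqxx orbT.
  have : g a' \in [set g a; g b] by rewrite E !inE eqxx.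
  have : g b' \in [set g a; g b] by rewrite E !inE eqxx orbT.
  by rewrite !inE => /orP[]/eqP/gI-> // /orP[]/eqP/gI-> // /orP[]/eqP/gI ? // /orP[]/eqP/gI ? //; lia.
(* Distinct pairs could give the same edge only with differences d and m - d; but 2d <= k < m in the
   circulant part, and the matching only starts below [m./2]. *)
have edI : {in Ix &, injective ed}.
  move=> [x d] [x' d'] zI zI' /pairE E.
  have := IxP _ zI; have := IxP _ zI'; have := z2m _ zI; have := z2m _ zI'.
  move=> /= d'm dm [x'm h'] [xm h].
  have {}E := E xm (shm (x, d) xm dm) x'm (shm (x', d') x'm d'm).
  suff [-> ->] : x = x' /\ d = d' by [].
  by move: E h h'; rewrite /sh /=; case: ifP; case: ifP; lia.
exists [set e in [seq ed z | z <- Ix]]; split.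
- move=> e; rewrite inE => /mapP[z zI ->]; have [z1 hz] := IxP _ zI.
  have z2 := z2m _ zI; have zm := shm _ z1 z2; split.
    have ne : z.1 <> sh (z.1 + z.2) by move: hz; rewrite /sh; case: ifP; lia.
    by rewrite cards2; case: eqP => // /(gI _ _ z1 zm).
  by apply/subsetP => v; rewrite !inE => /orP[]/eqP->; apply: gU.
- rewrite cardsE (card_uniqP _) ?map_inj_in_uniq // size_map size_cat size_allpairs.
  rewrite !size_iota; have := odd_double_half k; case: (odd k) => /=; rewrite ?size_map ?size_iota; nia.
move=> v; have [vU|vU] := boolP (v \in U); last first.
  rewrite (_ : nbr _ v = set0) ?cards0 //; apply/setP => y; rewrite !inE.
  apply/negP => /andP[_ /mapP[z zI E]]; case/negP: vU.
  have : v \in [set v; y] by rewrite !inE eqxx.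
  have [z1 _] := IxP _ zI.
  by rewrite E !inE => /orP[]/eqP->; apply: gU => //; apply: shm => //; apply: z2m.
have [a am va] : exists2 a, a < m & v = g a.
  by exists (index v (enum U)); rewrite ?/m ?cardE ?index_mem ?mem_enum // /g nth_index // mem_enum.
(* The possible neighbours of [g a]: positions a + d, a - d written as a + (m - d), and for odd [k]
   the matching partner. *)
pose N := [seq g (sh (a + d)) | d <- iota 1 k./2] ++ [seq g (sh (a + (m - d))) | d <- iota 1 k./2]
   ++ (if odd k then [:: if a < m./2 then g (a + m./2) else g (a - m./2)] else [::]).
have szN : size N = k.
  by rewrite !size_cat !size_map size_iota; have := odd_double_half k; case: (odd k) => /=; lia.
rewrite -szN; apply: leq_trans (card_size N); apply: subset_leq_card.
apply/subsetP => y; rewrite !inE => /andP[yv /mapP[[x d] zI E]].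
have [x_lt hz] := IxP _ zI; have d_lt := z2m _ zI; have xd_lt := shm _ x_lt d_lt.
rewrite /ed /= in x_lt hz d_lt xd_lt E.
have [b bm yb] : exists2 b, b < m & y = g b.
  have : y \in [set v; y] by rewrite !inE eqxx orbT.
  by rewrite E !inE => /orP[]/eqP->; [exists x|exists (sh (x + d))].
rewrite va yb in E *; have {}E := pairE _ _ _ _ am bm x_lt xd_lt E.
rewrite !mem_cat; case/orP: hz => [dk|/andP[/andP[ok /eqP dm] xm]].
  case: E => [[ax bx]|[ax bx]].
    by apply/orP; left; apply/mapP; exists d; rewrite ?mem_iota ?ax ?bx //; lia.
  apply/orP; right; apply/orP; left; apply/mapP; exists d; first by rewrite mem_iota; lia.
  congr g; rewrite bx ax /sh; clear -x_lt d_lt; set M := m in x_lt d_lt *.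
  by case: (ltnP (x + d) M) => ?; case: ifP; lia.
apply/orP; right; apply/orP; right; rewrite ok inE; apply/eqP.
case: E => [[ax bx]|[ax bx]]; rewrite ?ax ?bx dm /sh.
  by rewrite xm; case: ifP => //; lia.
by case: ifP; case: ifP => *; congr g; lia.
Qed.

(** Converse of [rainbow_of_forest], so that excluding rainbow copies also reduces to lists. *)
Lemma forest_of_rainbow n t p (C : eqType) (c : {set 'I_n} -> C) :
  @has_rainbow (complete n) (star_forest t p) C c ->
  exists ss : seq ('I_n * seq 'I_n),
    [/\ uniq (fverts ss), uniq [seq c e | e <- fedges ss] &
      fsizes ss = [seq p i.+1 | i <- iota 0 t]].
Proof.
case/existsP => f /and3P[/injectiveP injf _ /dinjectiveP rb].
pose ctr (j : 'I_t) : star_forest t p := existT (fun i : 'I_t => star (p i.+1) : Type) j None.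
pose leaf (j : 'I_t) (a : 'I_(p j.+1)) : star_forest t p :=
  existT (fun i : 'I_t => star (p i.+1) : Type) j (Some a).
exists [seq (f (ctr j), [seq f (leaf j a) | a <- enum 'I_(p j.+1)]) | j <- enum 'I_t]; split.
- have -> : fverts [seq (f (ctr j), [seq f (leaf j a) | a <- enum 'I_(p j.+1)]) | j <- enum 'I_t]
     = [seq f (existT (fun i : 'I_t => star (p i.+1) : Type) j o)
         | j <- enum 'I_t, o <- None :: [seq Some a | a <- enum 'I_(p j.+1)]].
    rewrite /fverts -map_comp; congr flatten; apply: eq_map => j /=.
    by rewrite -map_comp.
  apply: allpairs_uniq_dep; first exact: enum_uniq.
    move=> j _; rewrite /= map_inj_uniq ?enum_uniq ?andbT; last by move=> a b [].
    by apply/mapP => -[].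
  by move=> [i a] [j b] _ _ /= /injf.
- have -> : [seq c e | e <- fedges [seq (f (ctr j), [seq f (leaf j a) | a <- enum 'I_(p j.+1)])
         | j <- enum 'I_t]]
     = [seq c [set f (ctr j); f (leaf j a)] | j <- enum 'I_t, a <- enum 'I_(p j.+1)].
    rewrite map_flatten -!map_comp; congr flatten; apply: eq_map => j /=.
    by rewrite -!map_comp.
  apply: allpairs_uniq_dep; [exact: enum_uniq|by move=> *; exact: enum_uniq|].
  have copy j a : [set f (ctr j); f (leaf j a)] \in @copy_edges (complete n) (star_forest t p) f.
    apply/imsetP; exists [set ctr j; leaf j a]; last by rewrite imsetU1 imset_set1.
    apply/bigcupP; exists j => //; apply/imsetP; exists [set None; Some a].
      by apply/imsetP; exists a.
    by rewrite imsetU1 imset_set1.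
  move=> [i a] [j b] _ _ /= /(rb _ _ (copy i a) (copy j b)) E.
  have : f (ctr i) \in [set f (ctr j); f (leaf j b)] by rewrite -E !inE eqxx.
  have leaf_ctr k x : f (leaf k x) != f (ctr k).
    by apply/eqP => /injf/eqP; rewrite eq_Tagged.
  rewrite !inE => /orP[]/eqP/injf ij; have ij' : i = j := congr1 tag ij; last first.
    move: b ij {E}; rewrite -ij' => b /esym E.
    by have := leaf_ctr i b; rewrite E eqxx.
  move: b E {ij}; rewrite -ij' => b /(set2_inj (leaf_ctr _ _))/injf/eqP.
  by rewrite eq_Tagged => /eqP[->].
by rewrite /fsizes -map_comp -val_enum_ord -map_comp; apply: eq_map => j /=; rewrite size_map size_enum_ord.
Qed.

(** * Colorings with one common color outside a rainbow set *)

Section LowerBound.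

Variables (K F : sgraph) (X : {set {set K}}).

Definition color_in (e : {set K}) : option {set K} := if e \in X then Some e else None.

(** As [X] is a proper subset, some edge takes the color [None], which adds one to the [#|X|]
    private colors. *)
Lemma ar_ge_rainbow_set :
  X \proper edges K -> ~~ has_rainbow F color_in -> #|X|.+1 <= ar K F.
Proof.
case/properP => /subsetP XE [e0 e0E e0X] /ar_max; apply: leq_trans.
have -> : #|X|.+1 = #|None |: [set Some e | e in X]|.
  rewrite cardsU1 card_imset; last by move=> ? ? [].
  by case: imsetP => // -[].
apply/subset_leq_card/subsetP => o; rewrite !inE => /orP[/eqP->|/imsetP[e eX ->]].
  by apply/imsetP; exists e0; rewrite // /color_in (negPf e0X).
by apply/imsetP; exists e; rewrite ?XE // /color_in eX.
Qed.

End LowerBound.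

Lemma count_mem_le (T : finType) (A : {set T}) (s : seq T) :
  uniq s -> count (mem A) s <= #|A|.
Proof.
move=> us; rewrite -size_filter -(card_uniqP (filter_uniq _ us)).
by apply/subset_leq_card/subsetP => v; rewrite mem_filter => /andP[].
Qed.

Section LowerConstruction.

Variables (n : nat) (A : {set 'I_n}) (R : {set {set 'I_n}}).

Let X := [set e : {set 'I_n} | (#|e| == 2) && ~~ [disjoint e & A]] :|: R.

Hypothesis R2 : {in R, forall e : {set 'I_n}, #|e| = 2 /\ e \subset ~: A}.

Let cX : {set 'I_n} -> option {set 'I_n} := @color_in (complete n) X.

(** A vertex outside [A] has more than [d] others outside [A], hence a non-neighbour in [R] among
    them; this gives an edge outside [X]. *)
Lemma ar_ge_construction F d :
  (forall v, #|nbr R v| <= d) -> #|A| + d.+1 < n ->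
  ~~ has_rainbow F (cX : {set complete n} -> _) ->
  #|A| * n + #|R| + 1 <= ar (complete n) F + 'C(#|A|.+1, 2).
Proof.
move=> Rd An /ar_ge_rainbow_set ge.
have -> : #|A| * n + #|R| + 1 = #|X| + 1 + 'C(#|A|.+1, 2).
  have := card_edges_meeting A; rewrite card_ord => <-.
  rewrite /X cardsU (_ : _ :&: R = set0) ?cards0 ?subn0; first by rewrite !addn1 addSn addnAC.
  apply/setP => e; rewrite !inE; apply/negP => /andP[/andP[_ /negP ndis] /R2[_ eA]].
  by apply: ndis; rewrite disjoints_subset.
rewrite leq_add2r addn1; apply: ge; apply/properP; split.
  by apply/subsetP => e; rewrite !inE => /orP[/andP[]//|/R2[->]].
have cA : #|~: A| = n - #|A| by have := cardsC A; rewrite card_ord; lia.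
have [v vA] : exists v, v \in ~: A by apply/set0Pn; rewrite -card_gt0 cA subn_gt0; apply: leq_ltn_trans An; apply: leq_addr.
have [y] : exists y, y \in ~: A :\ v :\: nbr R v.
  apply/set0Pn; rewrite -card_gt0 cardsD.
  have := cardsD1 v (~: A); rewrite vA cA add1n subn_gt0 => cD.
  apply: leq_ltn_trans (subset_leq_card (subsetIr _ _)) _.
  by apply: leq_ltn_trans (Rd v) _; rewrite -ltnS -cD ltn_subRL.
rewrite !inE => /and3P[nR yv yA]; exists [set v; y]; first by rewrite inE cards2 (eq_sym v) yv.
rewrite !inE negb_or negb_and negbK; apply/andP; split; last by move: nR; rewrite yv.
apply/orP; right; rewrite disjoints_subset; apply/subsetP => z; rewrite !inE.
by move: vA; rewrite inE => vA /orP[]/eqP->.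
Qed.

(* All edges avoiding A and outside R have the same color [None]. *)
Lemma rainbow_avoiding (ss : seq ('I_n * seq 'I_n)) :
  uniq [seq cX e | e <- fedges ss] -> {in fverts ss, forall v, v \notin A} ->
  size (fedges ss) <= count (mem R) (fedges ss) + 1.
Proof.
move=> us sA; rewrite -(count_predC (mem R)) leq_add2l.
have -> : count (predC (mem R)) (fedges ss) = count (pred1 None) [seq cX e | e <- fedges ss].
  rewrite count_map; apply: eq_in_count => e es /=; rewrite /cX /color_in !inE.
  suff -> : [disjoint e & A] by rewrite /= andbF /=; case: (e \in R).
  by rewrite disjoints_subset; apply/subsetP => v ve; rewrite inE sA // (mem_fedges es).
by rewrite count_uniq_mem // leq_b1.
Qed.

(** The stars are disjoint, so each star that meets [A] uses a vertex of [A] of its own. *)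
Lemma size_avoiding (ss : seq ('I_n * seq 'I_n)) :
  uniq (fverts ss) ->
  size ss <= size [seq x <- ss | all (fun v => v \notin A) (x.1 :: x.2)] + #|A|.
Proof.
move=> us; rewrite size_filter -(count_predC (fun x => all (fun v => v \notin A) (x.1 :: x.2))).
rewrite leq_add2l; apply: leq_trans (count_mem_le A us).
have hit y : ~~ all (fun v => v \notin A) (y.1 :: y.2) <= count (mem A) (y.1 :: y.2).
  case: allPn => // -[v vx /negPn vA] /=.
  by rewrite -[_ + _]/(count (mem A) (y.1 :: y.2)) -has_count; apply/hasP; exists v.
elim: ss {us} => // x ss IH.
by rewrite -[fverts _]/((x.1 :: x.2) ++ fverts ss) count_cat; apply: leq_add (hit x) IH.
Qed.

End LowerConstruction.

Lemma subseq_flatten_map (S T : eqType) (f : S -> seq T) (s1 s2 : seq S) :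
  subseq s1 s2 -> subseq (flatten (map f s1)) (flatten (map f s2)).
Proof.
elim: s2 s1 => [|x s2 IH] [|y s1] //=; first by rewrite sub0seq.
case: eqP => [->|_] /IH sub; first exact: cat_subseq.
exact: subseq_trans sub (suffix_subseq _ _).
Qed.

Lemma set_of_card (V : finType) k : k <= #|V| -> exists A : {set V}, #|A| = k.
Proof.
rewrite -cardsT => /subset_seq[l [ul szl _]].
by exists [set y in l]; rewrite cardsE (card_uniqP ul).
Qed.

Lemma sumn_ge2 (s : seq nat) :
  {in s, forall k, 0 < k} -> 2 * size s <= sumn s + count (geq 1) s.
Proof.
elim: s => //= k s IH pos; have k0 : 0 < k by apply: pos; rewrite mem_head.
have {}IH := IH (fun j js => pos j (@mem_behead _ (k :: s) j js)).
by case: k k0 {pos} => [|[|k]] //= _; lia.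
Qed.

(** * The two terms as lower bounds *)

Section Lower.

Variables (n t : nat) (p : nat -> nat).

Hypothesis p_mono : forall i j, 0 < i -> i <= j -> j <= t -> p j <= p i.

(** At most [j] of the first [j.+1] stars meet the [j] vertices of [A]. One that avoids [A] has at
    least [p j.+1] edges, of which at most [p j.+1 - 2] lie in [R] and at most one has color
    [None]. *)
Lemma lower_star j : j < t -> 1 < p j.+1 -> p j.+1 + j < n ->
  j * n + ((p j.+1 - 2) * (n - j))./2 + 1
  <= ar (complete n) (star_forest t p) + 'C(j.+1, 2).
Proof.
move=> jt p2 nbig; have [|A cA] := @set_of_card 'I_n j; first by rewrite card_ord; lia.
have cU : #|~: A| = n - j by have := cardsC A; rewrite card_ord cA; lia.
have [|R [R2 cR Rd]] := @near_regular _ (~: A) (p j.+1 - 2); first by rewrite cU; lia.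
have := @ar_ge_construction n A R R2 (star_forest t p) (p j.+1 - 2) Rd.
rewrite cR cA cU; apply; first by lia.
apply/negP => /forest_of_rainbow[ss [uv uc sz]].
have szs : size ss = t by rewrite -(size_map (fun x => size x.2)) -/(fsizes ss) sz size_map size_iota.
have sub1 : subseq (take j.+1 ss) ss by apply: take_subseq.
have := @size_avoiding n A (take j.+1 ss).
have -> : uniq (fverts (take j.+1 ss)).
  by move: uv; rewrite -{1}(cat_take_drop j.+1 ss) fverts_cat cat_uniq => /and3P[].
rewrite cA size_takel ?szs // => /(_ isT).
case E : [seq x <- take j.+1 ss | _] => [|x ss'] /=; first by rewrite add0n ltnn.
move=> _; have : x \in x :: ss' by rewrite mem_head.
rewrite -E mem_filter => /andP[/allP xA xss].
have xs : x \in ss by apply: mem_take xss.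
have px : p j.+1 <= size x.2.
  have /(nthP x)[i] := xss; rewrite size_takel ?szs // => ij.
  rewrite nth_take // => xi.
  have : nth 0 (fsizes ss) i = size x.2 by rewrite (nth_map x) ?xi // szs; lia.
  rewrite sz (nth_map 0) ?size_iota ?nth_iota; try lia.
  by move=> <-; apply: p_mono => //; lia.
have := @rainbow_avoiding n A R [:: x].
have -> : uniq [seq @color_in (complete n) ([set e : {set 'I_n} | (#|e| == 2) && ~~ [disjoint e & A]] :|: R) e
    | e <- fedges [:: x]].
  by apply: subseq_uniq uc; apply/map_subseq/subseq_flatten_map; rewrite sub1seq.
have fv : fverts [:: x] = x.1 :: x.2 by rewrite /fverts /= cats0.
have fe : fedges [:: x] = [seq [set x.1; y] | y <- x.2] by rewrite /fedges /= cats0.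
move=> /(_ isT); rewrite fv fe size_map count_map => /(_ xA) le.
suff : count (preim (fun y => [set x.1; y]) (mem R)) x.2 <= p j.+1 - 2.
  by move=> small; have := leq_trans px (leq_trans le (leq_add small (leqnn 1))); lia.
apply: leq_trans (Rd x.1); rewrite -size_filter.
have ux : uniq (x.1 :: x.2).
  rewrite -fv; by apply: subseq_uniq uv; apply: subseq_flatten_map; rewrite sub1seq.
rewrite -(card_uniqP (filter_uniq _ _)); last by case/andP: ux.
apply/subset_leq_card/subsetP => y; rewrite mem_filter => /andP[yR yx].
by rewrite inE [_ \in R]yR andbT; apply: contraTneq ux => <-; rewrite /= yx.
Qed.

(** At least two stars avoid the t - 2 vertices of [A], and together they have at most [#|R| + 1]
    edges, that is 1 or 2. But two stars have at least 2 edges, and at least 3 when at most one of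
    them is a single edge. *)
Lemma lower_match : 1 < t -> 0 < p t -> t < n ->
  (t - 2) * n + (if p t.-1 == 1 then 1 else 2)
  <= ar (complete n) (star_forest t p) + 'C(t.-1, 2).
Proof.
move=> t2 pt tn; have [|A cA] := @set_of_card 'I_n (t - 2); first by rewrite card_ord; lia.
have cU : #|~: A| = n - (t - 2) by have := cardsC A; rewrite card_ord cA; lia.
have [R R2 cR] : exists2 R : {set {set 'I_n}},
    {in R, forall e : {set 'I_n}, #|e| = 2 /\ e \subset ~: A} & #|R|.+1 = if p t.-1 == 1 then 1 else 2.
  case: eqP => _; first by exists set0; rewrite ?cards0 // => e; rewrite inE.
  have [|l [ul szl lU]] := @subset_seq _ (~: A) 2; first by rewrite cU; lia.
  case: l szl ul lU => [|x [|y []]] // _; rewrite /= inE andbT => xy lU.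
  exists [set [set x; y]]; rewrite ?cards1 // => e; rewrite inE => /eqP->.
  rewrite cards2 xy; split=> //; apply/subsetP => z; rewrite in_set2 => zxy.
  by apply: lU; rewrite !inE.
have Rd v : #|nbr R v| <= 1.
  rewrite card_nbr => [|e /R2[]//]; apply: (@leq_trans #|R|).
    by apply/subset_leq_card/subsetP => e; rewrite inE => /andP[].
  by move: cR; case: ifP; lia.
have := @ar_ge_construction n A R R2 (star_forest t p) 1 Rd.
rewrite cA -addnA addn1 cR; have -> : (t - 2).+1 = t.-1 by lia.
apply; first by lia.
apply/negP => /forest_of_rainbow[ss [uv uc sz]].
have szs : size ss = t by rewrite -(size_map (fun x => size x.2)) -/(fsizes ss) sz size_map size_iota.
have := @size_avoiding n A ss uv; set ss' := [seq x <- ss | _]; rewrite cA szs => szss'.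
have sub : subseq ss' ss by apply: filter_subseq.
have := @rainbow_avoiding n A R ss'.
have -> : uniq [seq @color_in (complete n) ([set e : {set 'I_n} | (#|e| == 2) && ~~ [disjoint e & A]] :|: R) e
    | e <- fedges ss'].
  by apply: subseq_uniq uc; apply/map_subseq/subseq_flatten_map.
move=> /(_ isT) avoid; have /avoid : {in fverts ss', forall v, v \notin A}.
  move=> v /flattenP[_ /mapP[x xs ->] vx].
  by move: xs; rewrite mem_filter => /andP[/allP xA _]; apply: xA.
have ue : uniq (fedges ss').
  by apply: subseq_uniq (uniq_fedges uv); apply: subseq_flatten_map.
rewrite size_fedges => /leq_trans/(_ (leq_add (count_mem_le R ue) (leqnn 1))) total.
have sfs : subseq (fsizes ss') [seq p i.+1 | i <- iota 0 t] by rewrite -sz; apply: map_subseq.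
have pos : {in fsizes ss', forall k, 0 < k}.
  move=> k /(mem_subseq sfs)/mapP[i]; rewrite mem_iota => it ->.
  by apply: leq_trans pt (p_mono _ _ _) => //; lia.
have := sumn_ge2 pos; have := leq_count_subseq (geq 1) sfs.
(* If [p t.-1] is not 1, it is at least 2 since [p t] is positive, so only the last star can be a
   single edge. *)
have : p t.-1 != 1 -> count (geq 1) [seq p i.+1 | i <- iota 0 t] <= 1.
  move=> pt1; have -> : t = t.-1 + 1 by lia.
  rewrite iotaD map_cat count_cat /= (eq_in_count (a2 := pred0)) ?count_pred0; first by lia.
  move=> k /mapP[i]; rewrite mem_iota => it ->.
  have := p_mono (_ : 0 < i.+1) (_ : i.+1 <= t.-1) (leq_pred t).
  have := p_mono (_ : 0 < t.-1) (leq_pred t) (leqnn t).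
  by move=> /= /(_ ltac:(lia)) a /(_ isT ltac:(lia)) b; apply/negbTE; rewrite -ltnNge; lia.
have := count_size (geq 1) (fsizes ss').
have : t <= size (fsizes ss') + (t - 2) by rewrite size_map.
move=> big cle one le two; move: total one; rewrite addn1 cR; case: eqP => _ total one.
  have size_le : size (fsizes ss') <= sumn (fsizes ss').
    by rewrite -(leq_add2r (size (fsizes ss'))) addnn -mul2n (leq_trans two) // leq_add2l.
  by have := leq_trans size_le total; lia.
have := leq_trans two (leq_add total (leq_trans le (one isT))); lia.
Qed.

End Lower.

(** * The anti-Ramsey number *)

Lemma exists_representatives (T C : finType) (c : T -> C) (E : {set T}) :
  exists G : {set T}, [/\ G \subset E, {in G &, injective c} & #|G| = #|c @: E|].
Proof.
case: (set_0Vmem E) => [->|[e0 _]].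
  by exists set0; rewrite imset0 !cards0; split=> // e f; rewrite inE.
pose r x := odflt e0 [pick e in E | c e == x].
have rP x : x \in c @: E -> r x \in E /\ c (r x) = x.
  case/imsetP => e eE ->; rewrite /r; case: pickP => [f /andP[fE /eqP]//|/(_ e)].
  by rewrite eE eqxx.
have rI : {in c @: E &, injective r}.
  by move=> x y /rP[_ cx] /rP[_ cy] rxy; rewrite -cx -cy rxy.
exists (r @: (c @: E)); split; last exact: card_in_imset.
  by apply/subsetP => _ /imsetP[x /rP[rE _] ->].
by move=> _ _ /imsetP[x /rP[_ cx] ->] /imsetP[y /rP[_ cy] ->]; rewrite cx cy => ->.
Qed.

Local Open Scope ring_scope.

(** Both hypotheses keep the truncated subtractions exact, so the integer floor becomes the half of
    a natural number. *)
Lemma star_boundE (p : nat -> nat) n j : (1 < p j.+1)%N -> (j < n)%N ->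
  star_bound p n j.+1 =
  (j * n + ((p j.+1 - 2) * (n - j))./2 + 1)%N%:Z - 'C(j.+1, 2)%:Z.
Proof.
move=> p2 jn; rewrite /star_bound.
have -> : ((p j.+1)%:Z - 2) * (n%:Z - j.+1%:Z + 1) = ((p j.+1 - 2) * (n - j))%N%:Z.
  by rewrite PoszM -!subzn //; lia.
by rewrite divz_nat divn2 !PoszD PoszM; set x := _./2; lia.
Qed.

Theorem theorem8 (t : nat) (p : nat -> nat) (s r n : nat)
    (ht : (1 <= t)%N)
    (hp1 : (3 <= p 1)%N)
    (hmono : forall i j : nat, (1 <= i)%N -> (i <= j)%N -> (j <= t)%N ->
       (p j <= p i)%N)
    (hpt : (1 <= p t)%N)
    (hs : s = \max_(1 <= i < t.+1 | (2 <= p i)%N) i)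
    (hr : r = if (2 <= t)%N && (p t.-1 == 1%N) then 1%N else 2%N)
    (hn : (3 * t ^ 2 * (p 1 + 1) ^ 2 <= n)%N) :
  (ar (complete n) (star_forest t p))%:Z =
    Num.max (\big[Num.max/star_bound p n 1]_(1 <= i < s.+1) star_bound p n i)
            ((t%:Z - 2) * n%:Z - 'C(t.-1, 2)%:Z + r%:Z).
Proof.
(* [p] is nonincreasing, so the indices i with [p i >= 2] are exactly 1, ..., [s]; here [j] is i -
   1. *)
have s_spec j : (j < t)%N -> (1 < p j.+1)%N = (j < s)%N.
  move=> jt; apply/idP/idP => [pj|].
    by rewrite hs; apply: leq_bigmax_seq; rewrite ?mem_index_iota.
  apply: contraLR; rewrite -!leqNgt => pj; rewrite hs.
  apply/bigmax_leqP_seq => i; rewrite mem_index_iota => /andP[i0 it] pi.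
  by rewrite leqNgt; apply/negP => ji; have := hmono j.+1 i isT ji it; lia.
have s_le : (s <= t)%N.
  rewrite hs; apply/bigmax_leqP_seq => i; rewrite mem_index_iota ltnS.
  by case/andP.
have s_gt0 : (0 < s)%N by rewrite -s_spec // ltnW.
have n_large : (3 * t ^ 2 * (p 1).+1 ^ 2 <= n)%N by rewrite -(addn1 (p 1)).
have n_big : (p 1 + t < n)%N by move: n_large ht hp1; clear; rewrite -!mulnn; nia.
have p_small j : (j < t)%N -> (p j.+1 <= p 1)%N by move=> jt; apply: hmono.
set a := ar _ _.
apply/eqP; rewrite eq_le; apply/andP; split.
  rewrite leNgt gt_max; apply/negP => /andP[star_lt match_lt].
  have {}star_lt j : (j < s)%N -> star_bound p n j.+1 < a%:Z.
    move=> js; apply: le_lt_trans star_lt; apply: le_bigmax_seq => //.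
    by rewrite mem_index_iota ltnS.
  have a_gt0 : (0 < a)%N.
    have := star_lt 0 s_gt0; rewrite star_boundE ?(ltnW hp1) //; last by lia.
    by rewrite bin_small // mul0n subr0; lia.
  (* If [a] exceeded both terms, every coloring with at least [a] colors would contain a rainbow
     copy, and the maximum [a] would be at most [a.-1], which is absurd as [a] is positive. *)
  suff : (a <= a.-1)%N by lia.
  apply/bigmax_leqP => c; apply: contraNT; rewrite -ltnNge prednK // => cbig.
  have [G [GE cinj cG]] := exists_representatives c (edges (complete n)).
  have G2 : {in G, forall e : {set 'I_n}, #|e| = 2}.
    by move=> e /(subsetP GE)/(@complete_card2 n).
  apply: (@rainbow_upper n t p _ c G hmono G2 cinj) => //.
    move=> j jt pj; have js : (j < s)%N by rewrite -s_spec.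
    have := star_lt j js; rewrite star_boundE //; last by lia.
    by move=> lt; rewrite cG; apply: leq_trans (leq_add cbig (leqnn _)); move: lt; clear; lia.
  move=> t2; rewrite cG; apply: leq_trans (leq_add cbig (leqnn _)).
  move: match_lt; rewrite hr t2 /=; clear -t2.
  have [u ->] : exists u, t = u.+2 by exists t.-2; lia.
  by rewrite !subSS subn0 /=; case: ifP; lia.
rewrite ge_max; apply/andP; split.
  have star_le j : (j < s)%N -> star_bound p n j.+1 <= a%:Z.
    move=> js; have jt : (j < t)%N by apply: leq_trans s_le.
    have pj : (1 < p j.+1)%N by rewrite s_spec.
    have jn : (p j.+1 + j < n)%N by have := p_small _ jt; lia.
    rewrite star_boundE //; last by lia.
    by have := lower_star hmono jt pj jn; rewrite -/a; lia.
  rewrite big_nat; apply: bigmax_le => [|i /andP[i0 is_]]; first exact: star_le.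
  by case: i i0 is_ => // i _; rewrite ltnS; apply: star_le.
(* For t = 1 the second term is 2 - n, which is negative. *)
have [t2|t1] := ltnP 1 t; last first.
  have -> : t = 1%N by lia.
  by rewrite hr ltnNge t1 /=; lia.
have := lower_match hmono t2 hpt (leq_ltn_trans (leq_addl _ _) n_big); rewrite -/a hr t2 /=.
have [u ->] : exists u, t = u.+2 by exists t.-2; lia.
by rewrite !subSS subn0 /=; case: ifP; lia.
Qed.
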